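(* Let $n\ge 2$, $\sigma>0$, let $\mathcal{T}$ be the set of $n\times n$ real lower triangular matrices, and let $\bar L\in\mathcal{T}$ and $\bar b\in\mathbb{R}^n$ satisfy $\|\bar L\|_{\max}\le 1$ and $\|\bar b\|_\infty\le 1$. Assume systems $Lx=b$ are solved using forward substitution with finite precision, with machine precision $\varepsilon_{\mathsf{mach}}$. Then, for $(L,b)\sim N_{\mathcal{T}}((\bar L,\bar b),\sigma^2\mathrm{Id})$, the loss of precision $\mathsf{LoP}(x)$ in the computation of $x=L^{-1}b$ satisfies $$\mathbb{E}(\mathsf{LoP}(x))\;\le\;\log_{10}\left(\frac{1+\sigma}{\sigma}\right)+5\log_{10}n+\log_{10}(\log_2 n)+1.452+o(1),$$ where $o(1)$ is a quantity that tends to zero as $\varepsilon_{\mathsf{mach}}\to 0$ (for fixed $n,\sigma,\bar L,\bar b$).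
   Context: Norms: $\|A\|_{\max}=\max_{i,j}|a_{ij}|$ and $\|b\|_\infty=\max_i|b_i|$. Random data: $(L,b)\sim N_{\mathcal{T}}((\bar L,\bar b),\sigma^2\mathrm{Id})$ means that the entries $l_{ij}$ with $i\ge j$ and the entries $b_i$ are independent Gaussian random variables with $l_{ij}\sim N(\bar l_{ij},\sigma^2)$ and $b_i\sim N(\bar b_i,\sigma^2)$, while $l_{ij}=0$ for $i<j$. Finite precision: a finite precision algorithm with machine precision $\varepsilon_{\mathsf{mach}}>0$ rounds off every real number $z$ occurring in the execution to a number $\tilde z$ with $\mathsf{RelError}(z):=\frac{|\tilde z-z|}{|z|}\le\varepsilon_{\mathsf{mach}}$ (with the convention that $\mathsf{RelError}(z)=0$ if $z=\tilde z=0$). The implementation of forward substitution considered has the following backward error guarantee: for $\varepsilon_{\mathsf{mach}}$ sufficiently small (of the order of $(\log n)^{-1}$), for every nonsingular $L=(l_{ij})\in\mathcal{T}$ and $b\in\mathbb{R}^n$, the computed solution $\tilde x$ of $Lx=b$ satisfies $(L+E)\tilde x=b$ for some matrix $E=(e_{ij})$ with $|e_{ij}|\le(2\log_2 n)\,\varepsilon_{\mathsf{mach}}\,|l_{ij}|$ for all $i,j$. Loss of precision: with $x=L^{-1}b$ the exact solution and $\tilde x$ the computed one, $\mathsf{RelError}(x):=\max_{1\le i\le n}\mathsf{RelError}(x_i)=\max_{1\le i\le n}\frac{|\tilde x_i-x_i|}{|x_i|}$ (with the convention that $\mathsf{RelError}(x_i)=0$ if $x_i=\tilde x_i=0$), and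 $$\mathsf{LoP}(x):=\log_{10}(\varepsilon_{\mathsf{mach}}^{-1})-\log_{10}(\mathsf{RelError}(x)^{-1}).$$ By convention $\mathsf{LoP}(x)=\infty$ if $L$ is singular (an event of probability zero). *)

(* Defs.v *)
From HB Require Import structures.
From mathcomp Require Import all_boot all_order all_algebra.
From mathcomp Require Import all_classical all_reals all_analysis.

Set Implicit Arguments.
Unset Strict Implicit.
Unset Printing Implicit Defensive.

Import Order.TTheory GRing.Theory Num.Theory.
Import numFieldNormedType.Exports.

Local Open Scope classical_set_scope.
Local Open Scope ring_scope.

Definition log2 (R : realType) (x : R) : R := ln x / ln 2.

Definition log10 (R : realType) (x : R) : R := ln x / ln 10.

(* Extended logarithm: log10e 0 = -oo and log10e +oo = +oo. *)
Definition log10e (R : realType) (x : \bar R) : \bar R :=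
  (lne x * ((ln (10 : R))^-1)%:E)%E.

(* When x = 0 != xt the quotient is +oo, by inversion in \bar R. *)
Definition RelError (R : realType) (x xt : R) : \bar R :=
  if (x == 0) && (xt == 0) then 0%E
  else (`|xt - x|%:E / `|x|%:E)%E.

Definition RelErrorV (R : realType) (n : nat) (x xt : 'cV[R]_n) : \bar R :=
  \big[maxe/0%E]_(i < n) RelError (x i 0) (xt i 0).

(* The value is -oo when xt is the exact solution, and +oo when some exact
   coordinate vanishes and the computed one does not. *)
Definition LoP (R : realType) (n : nat) (eps : R)
    (L : 'M[R]_n) (b xt : 'cV[R]_n) : \bar R :=
  if L \in unitmx then
    (log10e (eps^-1)%:E - log10e (RelErrorV (invmx L *m b) xt)^-1)%E
  else +oo%E.

(* [solve eps L b] is the vector computed with machine precision eps.  Forward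
   substitution in finite precision enters only through its backward error
   bound, so any implementation satisfying that bound is covered, whatever the
   order of summation and the rounding rule.  The dimension being fixed, "eps
   sufficiently small" leaves the threshold free to depend on n. *)
Definition backward_error_guarantee (R : realType) (n : nat)
    (solve : R -> 'M[R]_n -> 'cV[R]_n -> 'cV[R]_n) : Prop :=
  \forall eps \near (0 : R)^'+,
    forall (L : 'M[R]_n) (b : 'cV[R]_n), is_trig_mx L -> L \in unitmx ->
    exists E : 'M[R]_n,
      (forall i j, `|E i j| <= 2 * log2 n%:R * eps * `|L i j|) /\
      (L + E) *m solve eps L b = b.

Definition mutually_independent d (Omega : measurableType d) (R : realType)
    (P : probability Omega R) (I : finType) (D : {set I})
    (X : I -> {RV P >-> R}) : Prop :=
  forall (J : {set I}) (A : I -> set R), J \subset D ->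
    (forall k, k \in J -> measurable (A k)) ->
    P (\bigcap_(k in [set` J]) (X k @^-1` A k)) =
    (\big[*%E/1%E]_(k in J) P (X k @^-1` A k)).

(* The law is compared on measurable sets only: off them [normal_prob], a
   formal integral, and the pushforward of P carry no meaning. *)
Definition is_gaussian d (Omega : measurableType d) (R : realType)
    (P : probability Omega R) (X : {RV P >-> R}) (m sigma : R) : Prop :=
  forall A : set R, measurable A -> distribution P X A = normal_prob m sigma A.

Definition random_mx d (Omega : measurableType d) (R : realType)
    (P : probability Omega R) (n : nat) (L : 'I_n -> 'I_n -> {RV P >-> R})
    (w : Omega) : 'M[R]_n := \matrix_(i, j) L i j w.

Definition random_cV d (Omega : measurableType d) (R : realType)
    (P : probability Omega R) (n : nat) (b : 'I_n -> {RV P >-> R})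
    (w : Omega) : 'cV[R]_n := \col_i b i w.

(* Entries of (L, b) as one family: [inl (i, j)] is l_ij and [inr i] is b_i. *)
Definition data_entry d (Omega : measurableType d) (R : realType)
    (P : probability Omega R) (n : nat) (L : 'I_n -> 'I_n -> {RV P >-> R})
    (b : 'I_n -> {RV P >-> R}) (k : 'I_n * 'I_n + 'I_n) : {RV P >-> R} :=
  match k with inl (i, j) => L i j | inr i => b i end.

Definition random_index (n : nat) : {set 'I_n * 'I_n + 'I_n} :=
  [set k : 'I_n * 'I_n + 'I_n |
    match k with inl (i, j) => (j <= i)%N | inr _ => true end]%SET.

Definition gaussian_triangular d (Omega : measurableType d) (R : realType)
    (P : probability Omega R) (n : nat) (Lbar : 'M[R]_n) (bbar : 'cV[R]_n)
    (sigma : R) (L : 'I_n -> 'I_n -> {RV P >-> R})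
    (b : 'I_n -> {RV P >-> R}) : Prop :=
  [/\ forall i j : 'I_n, (j <= i)%N -> is_gaussian (L i j) (Lbar i j) sigma,
      forall i j : 'I_n, (i < j)%N -> forall w, L i j w = 0,
      forall i : 'I_n, is_gaussian (b i) (bbar i 0) sigma &
      mutually_independent (random_index n) (data_entry L b)].

(* Main.v *)
Require Import Defs.
From HB Require Import structures.
From mathcomp Require Import all_boot all_order all_algebra.
From mathcomp Require Import all_classical all_reals all_analysis.
From mathcomp Require Import measurable_realfun ring lra.

Set Implicit Arguments.
Unset Strict Implicit.
Unset Printing Implicit Defensive.

Import Order.TTheory GRing.Theory Num.Theory.
Import numFieldNormedType.Exports.

Local Open Scope classical_set_scope.
Local Open Scope ring_scope.

(** Let V be the inverse of L and x = V b.  The computed vector xt solves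
    (L + E) xt = b with |E i j| <= h |L i j|, where h = c eps and
    c = 2 log2 n.  Hence L + E is lower triangular as well, and dividing row j
    by 1 + E j j / L j j leaves only perturbations of b and of the strictly
    lower part of L, of relative size at most e = h / (1 - h) and 2 e.  The
    relative errors of the x_i then satisfy a recursion in i whose coefficients
    are the sensitivities |b_j V_ij / x_i| and |L_jk V_ij x_k / x_i|, k < j.
    If W is the sum of all of them over i, j, k, the second kind counted twice,
    induction on i bounds every relative error by e W (1 + e W)^n
    ([forward_error_le]).  This is an inequality at fixed eps, with no
    remainder term, so it can be integrated as it stands.

    Each x_i is an affine function al + l be of any single datum l = b_j, and
    of l = L_jk with k < j, where al and be do not involve l.  The sensitivity
    to l is thus |l be / (al + l be)|, at most |l / (l - a)| with
    a = - al / be independent of l ([entry_quotient_le],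
    [coord_quotient_le]).  A Gaussian density is bounded, so for p < 1 the
    p-th moment of l / (l - a) is bounded by a multiple of
    ((1 + sigma) / sigma)^p uniformly in a ([gaussian_quotient_moment]);
    independence and Tonelli let a be random ([integral_independent_le]).

    As t |-> t^p is subadditive, the expectation of W^p is at most the sum of
    these moments: n values of i, and n^2 sensitivities with multiplicity for
    each, give E W^p <= K with K of order n^3.  The tangent inequality
    ln W <= (W^p / K - 1 + ln K) / p yields E ln W <= (ln K) / p, and p = 3/5
    turns n^3 into the required n^5.  The factor (1 + e W)^n contributes at
    most n E (e W)^p / p <= n e^p K / p, which tends to 0 with eps: it is the
    main part of o(1).  What remains is a comparison of numerical constants.

    The loss of precision equals +oo only when some L_ii or some x_i
    vanishes.  Adding to the majorant a term equal to +oo exactly when such an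
    event occurs ([degeneracy]) makes it valid everywhere at no cost, since
    that term has integral 0. *)

(** * Moments of the quotient of a Gaussian variable *)

Lemma measurable_invr (R : realType) :
  measurable_fun [set: R] (fun x : R => x^-1).
Proof.
have -> : (fun x : R => x^-1) = (fun x : R => x * (x ^+ 2) `^ (-1)).
  apply/funext => x; rewrite powR_inv1 ?sqr_ge0//.
  have [->|x0] := eqVneq x 0; first by rewrite invr0 mul0r.
  by field.
apply: measurable_funM => //.
apply: (measurableT_comp (f := fun y : R => y `^ (-1))) => //.
Qed.

Section gaussian_moment.
Context (R : realType).
Local Notation mu := (@lebesgue_measure R).

Lemma measurable_powR_comp d (T : measurableType d) (D : set T) (f : T -> R) p :
  measurable_fun D f -> measurable_fun D (fun x => f x `^ p).
Proof.
by move=> mf; apply: (measurableT_comp (f := fun y : R => y `^ p)).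
Qed.

Lemma integral_is_derive (f F : R -> R) (a b : R) : a < b ->
  (forall z, a <= z <= b -> is_derive z 1 F (f z)) ->
  (forall z, a <= z <= b -> {for z, continuous f}) ->
  (\int[mu]_(z in `[a, b]) (f z)%:E = (F b - F a)%R%:E)%E.
Proof.
move=> ab dF cf.
have cF z : a <= z <= b -> {for z, continuous F}.
  move=> /dF dFz; apply/differentiable_continuous/derivable1_diffP.
  exact: ex_derive.
rewrite (continuous_FTC2 (F := F))//.
- apply: continuous_in_subspaceT => z; rewrite inE/= in_itv/=; exact: cf.
- split.
  + move=> z; rewrite in_itv/= => /andP[az zb]; apply: ex_derive.
    by apply: dF; rewrite !ltW.
  + by apply: cvg_at_right_filter; apply: cF; rewrite lexx ltW.
  + by apply: cvg_at_left_filter; apply: cF; rewrite lexx ltW.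
- move=> z; rewrite in_itv/= => /andP[az zb]; rewrite derive1E.
  have zab : a <= z <= b by rewrite !ltW.
  by have := dF z zab => h; rewrite derive_val.
Qed.

(** The sign e = 1 or -1 treats the two sides of the singularity c at once:
    e * (x - c) is the distance to c on the side chosen. *)
Lemma is_derive_dist_powR (e c p z : R) : p != 1 -> e ^+ 2 = 1 ->
  0 < e * (z - c) ->
  is_derive z 1 (fun x => e * ((e * (x - c)) `^ (1 - p) / (1 - p)))
    ((e * (z - c)) `^ (- p)).
Proof.
move=> p1 ee zc.
have dg : is_derive z (1 : R) (fun x : R => e * (x - c)) e.
  by apply: is_derive_eq; rewrite subr0 /GRing.scale/= mulr1 ?mul0r ?addr0.
have h := @is_derive1_comp R (fun x => x `^ (1 - p)) (fun x => e * (x - c)) z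
  _ _ (is_derive1_powR (1 - p) zc) dg.
rewrite (_ : (fun x => _) = (e / (1 - p)) *:
    ((fun x : R => x `^ (1 - p)) \o (fun x : R => e * (x - c)))); last first.
  by apply/funext => x; rewrite !fctE /GRing.scale/= mulrA mulrAC.
apply: is_derive_eq; rewrite /GRing.scale/=.
have -> : 1 - p - 1 = - p by ring.
have p1' : 1 - p != 0 by rewrite subr_eq0 eq_sym.
transitivity (e ^+ 2 * ((e * (z - c)) `^ (- p))); first by field.
by rewrite ee mul1r.
Qed.

Lemma integral_dist_powR_le (e c s p a b : R) : 0 < p < 1 -> e ^+ 2 = 1 ->
  a < b -> 0 < s -> (forall z, a <= z <= b -> 0 < e * (z - c) <= s) ->
  (\int[mu]_(z in `[a, b]) (`|z - c| `^ (- p))%:E <=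
   (s `^ (1 - p) / (1 - p))%:E)%E.
Proof.
move=> /andP[p0 p1] ee ab s0 zin.
have q0 : 0 < 1 - p by rewrite subr_gt0.
have e1 : `|e| = 1.
  by apply/eqP; rewrite -(@eqrXn2 _ 2)// ?expr1n// real_normK ?ee ?num_real.
have aab : a <= a <= b by rewrite lexx ltW.
have bab : a <= b <= b by rewrite lexx ltW.
have -> : (\int[mu]_(z in `[a, b]) (`|z - c| `^ (- p))%:E =
    \int[mu]_(z in `[a, b]) ((e * (z - c)) `^ (- p))%:E)%E.
  apply: eq_integral => z; rewrite inE/= in_itv/= => /zin /andP[h _].
  by rewrite -[`|z - c|]mul1r -e1 -normrM gtr0_norm.
have dF z : a <= z <= b ->
    is_derive z 1 (fun x => e * ((e * (x - c)) `^ (1 - p) / (1 - p)))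
      ((e * (z - c)) `^ (- p)).
  by move=> /zin /andP[h _]; apply: is_derive_dist_powR => //; rewrite lt_eqF.
rewrite (integral_is_derive ab dF) => [|z /zin /andP[h _]]; last first.
  apply: (@continuous_comp _ _ _ (fun x : R => e * (x - c))
    (fun x => x `^ (- p))).
    by apply: cvgM; [exact: cvg_cst|apply: cvgB; [exact: cvg_id|exact: cvg_cst]].
  apply/differentiable_continuous/derivable1_diffP.
  by apply: derivable_powR; rewrite in_itv/= h.
rewrite lee_fin -mulrBr -mulrBl mulrA ler_pM2r ?invr_gt0//.
have H x : a <= x <= b -> 0 <= (e * (x - c)) `^ (1 - p) <= s `^ (1 - p).
  move=> /zin /andP[x0 xs]; rewrite powR_ge0/= ge0_ler_powR// ?ltW//.
    by rewrite nnegrE ltW.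
  by rewrite nnegrE ltW.
have /andP[A0 As] := H _ aab; have /andP[B0 Bs] := H _ bab.
have /eqP := ee; rewrite -subr_eq0 subr_sqr_1 mulf_eq0 subr_eq0 addr_eq0.
by move=> /orP[/eqP e_eq|/eqP e_eq]; rewrite e_eq in A0 As B0 Bs *; lra.
Qed.

(** The integrand is unbounded at c, so the punctured ball is exhausted by the
    closed sets D k at distance at least s / (k + 2) from c; k + 2 keeps the
    two intervals of D k nondegenerate. *)
Lemma integral_ball_powR_le (c s p : R) : 0 < s -> 0 < p < 1 ->
  (\int[mu]_(z in [set z : R | (0 < `|z - c|) && (`|z - c| <= s)]%R)
     (`|z - c| `^ (- p))%:E <= (2 * (s `^ (1 - p) / (1 - p)))%:E)%E.
Proof.
move=> s0 p01.
pose D (k : nat) : set R :=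
  `[c - s, c - s / k.+2%:R]%classic `|` `[c + s / k.+2%:R, c + s]%classic.
have sk k : 0 < s / k.+2%:R < s.
  by rewrite divr_gt0//= ltr_pdivrMr// ltr_pMr// ltr1n.
have D_E : [set z : R | (0 < `|z - c|) && (`|z - c| <= s)] = \bigcup_k D k.
  apply/seteqP; split => z /=.
    move=> /andP[z0 zs].
    pose k := Num.truncn (s / `|z - c|).
    have hk : s / k.+2%:R <= `|z - c|.
      rewrite ler_pdivrMr// mulrC -ler_pdivrMr//.
      have := truncnS_gt (s / `|z - c|); rewrite -/k => /ltW/le_trans; apply.
      by rewrite ler_nat.
    exists k => //; rewrite /D /= !in_itv/=.
    move: (s / _) zs hk => t.
    by have [zc|zc] := ger0P (z - c) => zs hk; [right|left];
      apply/andP; split; lra.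
  move=> [k _]; rewrite /D /= !in_itv/= => h.
  move: (s / _) (sk k) h => t /andP[h0 h1] h.
  by case: h => /andP[h2 h3]; apply/andP; split;
    [rewrite ltr0_norm; lra|rewrite ltr0_norm; lra
    |rewrite gtr0_norm; lra|rewrite gtr0_norm; lra].
have mD k : measurable (D k) by exact: measurableU.
have mf : measurable_fun [set: R] (fun z => (`|z - c| `^ (- p))%:E).
  apply/measurable_EFinP; apply: measurable_powR_comp.
  by apply: measurableT_comp => //; exact: measurable_funB.
have ndD : nondecreasing_seq D.
  apply/nondecreasing_seqP => k; apply/subsetPset => z.
  have h : s / k.+3%:R <= s / k.+2%:R.
    by rewrite ler_pM2l// lef_pV2 ?posrE// ler_nat.
  rewrite /D; move: (s / k.+3%:R) (s / k.+2%:R) h => u t h.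
  by move=> [|] /=; rewrite !in_itv/= => /andP[z1 z2]; [left|right];
    apply/andP; split; lra.
rewrite D_E.
have := @ge0_nondecreasing_set_cvg_integral _ (measurableTypeR R) R D
  (fun z => (`|z - c| `^ (- p))%:E) mu ndD mD
  (fun k => measurable_funTS mf) (fun k z _ => powR_ge0 _ _).
move=> /cvg_lim <-//.
apply: lime_le.
  apply: ereal_nondecreasing_is_cvgn.
  apply: ge0_nondecreasing_set_nondecreasing_integral => //.
  by move=> k; exact: measurable_funTS.
apply: nearW => k.
rewrite /D; move: (s / k.+2%:R) (sk k) => t /andP[h0 h1].
rewrite ge0_integral_setU//=.
- rewrite [leRHS](_ : _ = (s `^ (1 - p) / (1 - p))%:E +
    (s `^ (1 - p) / (1 - p))%:E)%E; last first.
    by rewrite -EFinD; congr EFin; ring.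
  apply: leeD.
  + apply: (integral_dist_powR_le (e := -1)) => //; first by rewrite sqrrN expr1n.
      lra.
    by move=> z /andP[z1 z2]; apply/andP; split; lra.
  + apply: (integral_dist_powR_le (e := 1)) => //; first by rewrite expr1n.
      lra.
    by move=> z /andP[z1 z2]; apply/andP; split; lra.
- exact: measurable_funTS.
- rewrite disj_set2E; apply/eqP/seteqP; split => // z [] /=; rewrite !in_itv/=.
  by move=> /andP[z1 z2] /andP[z3 z4]; lra.
Qed.

(** The density of the normal law is its Radon-Nikodym derivative up to a null
    set, which turns the change of variables for the latter into an explicit
    formula. *)
Lemma ge0_integral_normal_prob (m s : R) (f : R -> \bar R) :
  measurable_fun [set: R] f -> (forall x, 0 <= f x)%E ->
  (\int[normal_prob m s]_x f x = \int[mu]_x (f x * (normal_pdf m s x)%:E))%E.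
Proof.
move=> mf f0.
have dom : normal_prob m s `<< mu by exact: normal_prob_dominates.
rewrite -(@Radon_Nikodym_SigmaFinite.change_of_variables _ _ R
  (normal_prob m s) mu dom f setT)//.
apply: ae_eq_integral => //.
- apply: emeasurable_funM => //; apply: (measurable_int mu).
  exact: Radon_Nikodym_SigmaFinite.f_integrable.
- apply: emeasurable_funM => //; apply/measurable_EFinP.
  exact: measurable_normal_pdf.
- apply: ae_eqe_mul2l => /=.
  apply: integral_ae_eq => //=.
  + exact: Radon_Nikodym_SigmaFinite.f_integrable.
  + by apply/measurable_EFinP; exact: measurable_normal_pdf.
  + move=> E _ mE.
    by rewrite -Radon_Nikodym_SigmaFinite.f_integral.
Qed.

Lemma normal_peak_le (s : R) : 0 < s -> normal_peak s <= (2 * s)^-1.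
Proof.
move=> s0; rewrite /normal_peak lef_pV2 ?posrE ?mulr_gt0// ?sqrtr_gt0; last first.
  by rewrite pmulrn_lgt0// mulr_gt0 ?pi_gt0// exprn_gt0.
have h : 0 <= 2 * s by rewrite mulr_ge0// ltW.
rewrite -(ger0_norm h) -sqrtr_sqr ler_wsqrtr// exprMn.
have := pi_ge2 R; have : 0 <= s ^+ 2 by exact: sqr_ge0.
move: (s ^+ 2) (pi : R) => x y x0 y2.
by nra.
Qed.

(** With u = (z - m) / s one has |z| <= (1 + s) exp (u^2 / 2); raising this to
    the power p uses up the fraction p of the Gaussian exponent, which leaves a
    Gaussian of standard deviation s / sqrt (1 - p). *)
Lemma normal_fun_absorbs_powR (m s p z : R) : 0 < s -> 0 < p < 1 ->
  `|m| <= 1 ->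
  `|z| `^ p * normal_fun m s z <=
  (1 + s) `^ p * normal_fun m (s / Num.sqrt (1 - p)) z.
Proof.
move=> s0 /andP[p0 p1] m1.
have q0 : 0 < 1 - p by rewrite subr_gt0.
pose u := (z - m) / s.
have s10 : 0 < 1 + s by rewrite addr_gt0.
have E1 : normal_fun m s z = expR (- (u ^+ 2 / 2)).
  rewrite /normal_fun; congr expR; rewrite /u -mulr_natr; field.
  by rewrite gt_eqF.
have E2 : normal_fun m (s / Num.sqrt (1 - p)) z =
    expR (p * (u ^+ 2 / 2)) * expR (- (u ^+ 2 / 2)).
  rewrite -expRD /normal_fun; congr expR.
  rewrite exprMn exprVn sqr_sqrtr ?ltW// /u -mulr_natr; field.
  by rewrite !gt_eqF.
rewrite E1 E2 mulrA ler_pM2r ?expR_gt0//.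
rewrite [p * _]mulrC expRM -powRM ?expR_ge0 ?(ltW s10)//.
apply: ge0_ler_powR; rewrite ?nnegrE ?(ltW p0)// ?mulr_ge0 ?expR_ge0 ?(ltW s10)//.
have h1 : `|z| <= 1 + s * `|u|.
  have -> : s * `|u| = `|z - m|.
    by rewrite /u normrM normfV (gtr0_norm s0) mulrC divfK// gt_eqF.
  rewrite (le_trans _ (lerD m1 (lexx _)))//.
  by rewrite -[X in `|X| <= _](subrK m z) addrC ler_normD.
have h2 : 1 + u ^+ 2 / 2 <= expR (u ^+ 2 / 2) by exact: expR_ge1Dx.
have h3 : 0 <= (`|u| - 1) ^+ 2 by exact: sqr_ge0.
have h4 : `|u| ^+ 2 = u ^+ 2 by rewrite real_normK ?num_real.
apply: (le_trans h1); apply: (@le_trans _ _ ((1 + s) * (1 + u ^+ 2 / 2))).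
  rewrite -h4; move: h3; have : 0 <= `|u| by []; move: `|u| => v v0 h3.
  by nra.
by rewrite ler_pM2l// addr_gt0.
Qed.

(** The moment is split at distance s from c.  Near c the density times |z|^p
    is at most (1 + s)^p / (2 s), and |z - c|^(- p) is integrable: this gives
    1 / (1 - p).  Far from c, |z - c|^(- p) is at most s^(- p), and what is
    left is a wider Gaussian: this gives 1 / sqrt (1 - p). *)
Lemma gaussian_quotient_moment (m s c p : R) : 0 < s -> 0 < p < 1 ->
  `|m| <= 1 ->
  (\int[normal_prob m s]_z (`|z / (z - c)| `^ p)%:E <=
   (((1 - p)^-1 + (Num.sqrt (1 - p))^-1) * ((1 + s) / s) `^ p)%:E)%E.
Proof.
move=> s0 p01 m1; have /andP[p0 p1] := p01.
have q0 : 0 < 1 - p by rewrite subr_gt0.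
have s10 : 0 < 1 + s by rewrite addr_gt0.
have mq : measurable_fun [set: R] (fun z => `|z / (z - c)| `^ p).
  apply: measurable_powR_comp; apply: measurableT_comp => //.
  apply: measurable_funM => //.
  by apply: measurableT_comp; [exact: measurable_invr|exact: measurable_funB].
rewrite ge0_integral_normal_prob//; last exact/measurable_EFinP.
pose B : set R := [set z | (0 < `|z - c|) && (`|z - c| <= s)].
pose t := s / Num.sqrt (1 - p).
have t0 : 0 < t by rewrite divr_gt0// sqrtr_gt0.
pose A1 := (1 + s) `^ p * (2 * s)^-1.
pose A2 := s `^ (- p) * (1 + s) `^ p * (Num.sqrt (1 - p))^-1.
have A10 : 0 <= A1 by rewrite mulr_ge0 ?powR_ge0// invr_ge0 mulr_ge0// ltW.
have A20 : 0 <= A2 by rewrite !mulr_ge0 ?powR_ge0// invr_ge0 sqrtr_ge0.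
have mB : measurable B.
  have -> : B = (`[c - s, c + s]%classic `\ c).
    apply/seteqP; split => z /=.
      move=> /andP[z0]; rewrite ler_norml in_itv/= => /andP[z1 z2].
      split; first by apply/andP; split; lra.
      by move=> zc; move: z0; rewrite zc subrr normr0 ltxx.
    rewrite in_itv/= => -[/andP[z1 z2] /eqP zc].
    rewrite /B /= normr_gt0 subr_eq0 zc/= ler_norml; apply/andP; split; lra.
  by apply: measurableD => //; exact: measurable_set1.
have mg : measurable_fun [set: R] (fun z : R => `|z - c| `^ (- p)).
  apply: measurable_powR_comp.
  by apply: measurableT_comp => //; exact: measurable_funB.
have pointwise z : `|z / (z - c)| `^ p * normal_pdf m s z <=
    A1 * (`|z - c| `^ (- p) * \1_B z) + A2 * normal_pdf m t z.
  have rhs1 : 0 <= A1 * (`|z - c| `^ (- p) * \1_B z).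
    by rewrite mulr_ge0// mulr_ge0 ?powR_ge0// indicE.
  have rhs2 : 0 <= A2 * normal_pdf m t z by rewrite mulr_ge0 ?normal_pdf_ge0.
  have [zc|zc] := eqVneq z c.
    rewrite [`|z / _|](_ : _ = 0); last by rewrite zc subrr invr0 mulr0 normr0.
    by rewrite powR0 ?gt_eqF// mul0r addr_ge0.
  have zc0 : 0 < `|z - c| by rewrite normr_gt0 subr_eq0.
  rewrite normrM normfV powRM ?invr_ge0// -powR_inv1 ?normr_ge0// -powRrM mulN1r.
  move: rhs1 rhs2; rewrite !normal_pdfE ?gt_eqF// => rhs1 rhs2.
  have pk0 : 0 < normal_peak s by rewrite normal_peak_gt0// gt_eqF.
  have abs : `|z| `^ p * normal_fun m s z <= (1 + s) `^ p * normal_fun m t z.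
    exact: normal_fun_absorbs_powR.
  have N1 : normal_fun m t z <= 1.
    rewrite -[leRHS]expR0 ler_expR mulNr oppr_le0 mulr_ge0// ?sqr_ge0//.
    by rewrite invr_ge0 mulrn_wge0// sqr_ge0.
  have pkt : normal_peak s = (Num.sqrt (1 - p))^-1 * normal_peak t.
    have t2 : (1 - p) * t ^+ 2 = s ^+ 2.
      by rewrite /t exprMn exprVn sqr_sqrtr ?ltW// mulrCA divff ?mulr1// gt_eqF.
    rewrite /normal_peak
      (_ : s ^+ 2 * pi *+ 2 = (1 - p) * (t ^+ 2 * pi *+ 2)); last first.
      by rewrite -t2 -[in LHS]mulrA -[in LHS]mulrnAr.
    by rewrite sqrtrM ?invfM// ltW.
  have P0 : 0 <= `|z - c| `^ (- p) by rewrite powR_ge0.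
  have [zs|zs] := lerP `|z - c| s.
    have Bz : B z by rewrite /B /= zc0.
    have -> : \1_B z = 1 :> R by rewrite indicE mem_set.
    rewrite mulr1 -[leLHS]addr0 lerD//.
    rewrite (_ : _ * _ = (`|z| `^ p * normal_fun m s z) *
      (normal_peak s * `|z - c| `^ (- p))); last by ring.
    apply: (@le_trans _ _ ((1 + s) `^ p * ((2 * s)^-1 * `|z - c| `^ (- p)))).
      apply: ler_pM.
      - by rewrite mulr_ge0 ?powR_ge0 ?expR_ge0.
      - by rewrite mulr_ge0 ?normal_peak_ge0.
      - by rewrite (le_trans abs)// ler_piMr ?powR_ge0.
      - by rewrite ler_wpM2r// normal_peak_le.
    by rewrite /A1 mulrA.
  rewrite -[leLHS]add0r lerD//.
  have zs' : `|z - c| `^ (- p) <= s `^ (- p).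
    rewrite !powRN lef_pV2 ?posrE ?powR_gt0//.
    by rewrite ge0_ler_powR// ?nnegrE// ltW.
  rewrite (_ : _ * _ = (`|z| `^ p * normal_fun m s z) *
    (normal_peak s * `|z - c| `^ (- p))); last by ring.
  rewrite (_ : A2 * _ = ((1 + s) `^ p * normal_fun m t z) *
    (normal_peak s * s `^ (- p))); last first.
    by rewrite /A2 pkt; ring.
  apply: ler_pM => //.
  - by rewrite mulr_ge0 ?powR_ge0 ?expR_ge0.
  - by rewrite mulr_ge0 ?normal_peak_ge0.
  - by rewrite ler_wpM2l// normal_peak_ge0.
apply: (@le_trans _ _ (\int[mu]_z
    (A1%:E * ((`|z - c| `^ (- p))%:E * (\1_B z)%:E) +
     A2%:E * (normal_pdf m t z)%:E))%E).
  apply: ge0_le_integral => //.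
  - by move=> z _; rewrite mule_ge0// lee_fin ?powR_ge0 ?normal_pdf_ge0.
  - apply: emeasurable_funM; apply/measurable_EFinP => //.
    exact: measurable_normal_pdf.
  - apply: emeasurable_funD; apply: emeasurable_funM => //;
      apply/measurable_EFinP.
      by apply: measurable_funM => //; exact: measurable_indic.
    exact: measurable_normal_pdf.
  - by move=> z _; rewrite -!EFinM -EFinD lee_fin; exact: pointwise.
rewrite ge0_integralD//; last 4 first.
- by move=> z _; rewrite !mule_ge0// lee_fin// powR_ge0.
- apply: emeasurable_funM => //; apply/measurable_EFinP.
  by apply: measurable_funM => //; exact: measurable_indic.
- by move=> z _; rewrite !mule_ge0// lee_fin// normal_pdf_ge0.
- apply: emeasurable_funM => //; apply/measurable_EFinP.
  exact: measurable_normal_pdf.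
rewrite ge0_integralZl//; last first.
  by apply/measurable_EFinP; exact: measurable_funM.
rewrite ge0_integralZl//; last 2 first.
- by apply/measurable_EFinP; exact: measurable_normal_pdf.
- by move=> z _; rewrite lee_fin// normal_pdf_ge0.
rewrite integral_normal_pdf mule1.
have -> : (\int[mu]_z ((`|z - c| `^ (- p))%:E * (\1_B z)%:E) =
           \int[mu]_(z in B) (`|z - c| `^ (- p))%:E)%E.
  rewrite [RHS]integral_mkcond; apply: eq_integral => z _.
  by rewrite epatch_indic.
have sE : ((1 + s) / s) `^ p = (1 + s) `^ p * s `^ (- p).
  have s0' := ltW s0; have s10' := ltW s10.
  by rewrite powRM ?invr_ge0// -(powR_inv1 s0') -powRrM mulN1r.
rewrite mulrDl EFinD; apply: leeD.
  apply: (@le_trans _ _ (A1%:E * (2 * (s `^ (1 - p) / (1 - p)))%:E)%E).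
    by rewrite lee_wpmul2l// integral_ball_powR_le.
  rewrite -EFinM lee_fin /A1 sE powRD ?gt_eqF ?implybT// powRr1 ?(ltW s0)//.
  rewrite le_eqVlt; apply/orP; left; apply/eqP; field.
  by rewrite !gt_eqF.
rewrite lee_fin /A2 sE.
by rewrite le_eqVlt; apply/orP; left; apply/eqP; ring.
Qed.

End gaussian_moment.

(** * One variable of an independent family against the others *)

(** The pi-system of finite-dimensional events of the variables of D other
    than k0; measurability for the sigma-algebra it generates expresses that a
    quantity is a function of these variables. *)
Definition other_cylinders d (Omega : measurableType d) (R : realType)
    (P : probability Omega R) (I : finType) (D : {set I})
    (X : I -> {RV P >-> R}) (k0 : I) : set (set Omega) :=
  [set S | exists2 A : I -> set R, forall k, measurable (A k) &
    S = \bigcap_(k in [set` (D :\ k0)%SET]) (X k @^-1` A k)].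

Section independence.
Context d (Omega : measurableType d) (R : realType) (P : probability Omega R).
Context (I : finType) (D : {set I}) (X : I -> {RV P >-> R}) (k0 : I).
Hypothesis indep : mutually_independent D X.
Hypothesis Dk0 : k0 \in D.

Local Notation G := (other_cylinders D X k0).

Lemma other_cylinders_measurable : G `<=` measurable.
Proof.
move=> _ [A mA ->]; apply: fin_bigcap_measurable => [|k _].
  exact: finite_finset.
by rewrite -[X in measurable X]setTI; exact: measurable_funP.
Qed.

Lemma other_cylinders_setI : setI_closed G.
Proof.
move=> _ _ [A mA ->] [B mB ->]; exists (fun k => A k `&` B k).
  by move=> k; exact: measurableI.
apply/seteqP; split => [w [hA hB] k kD|w h].
  by split; [exact: hA|exact: hB].
by split => k kD; case: (h k kD).
Qed.

Lemma other_cylinders_setT : G setT.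
Proof.
by exists (fun=> setT) => //; apply/esym; rewrite -subTset => w _ k _.
Qed.

Lemma measurable_of_others d' (T : measurableType d') (a : Omega -> T) :
  measurable_fun (T := g_sigma_algebraType G) setT a ->
  measurable_fun [set: Omega] a.
Proof.
move=> ma mD B mB.
apply: (smallest_sub (@sigma_algebra_measurable _ Omega)
  other_cylinders_measurable).
exact: ma.
Qed.

Lemma measurable_other k : k \in D -> k != k0 ->
  measurable_fun (T := g_sigma_algebraType G) setT (X k).
Proof.
move=> Dk kk0 _ B mB; rewrite setTI; apply: sub_sigma_algebra.
exists (fun l => if l == k then B else setT) => [l|]; first by case: ifP.
apply/seteqP; split => [w Xw l _|w /(_ k)] /=; last first.
  by rewrite eqxx; apply; rewrite /= in_setD1 kk0.
by have [->|] := eqVneq l k.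
Qed.

(** Both sides are finite measures in B which agree on the pi-system of
    cylinders, by mutual independence. *)
Lemma independent_of_others (A : set R) (B : set Omega) : measurable A ->
  <<s G >> B -> P (X k0 @^-1` A `&` B) = (P (X k0 @^-1` A) * P B)%E.
Proof.
move=> mA sB.
have mXA : measurable (X k0 @^-1` A).
  by rewrite -[X in measurable X]setTI; exact: measurable_funP.
pose r : {nonneg R} := NngNum (fine_ge0 (measure_ge0 P (X k0 @^-1` A))).
have rE : r%:num%:E = P (X k0 @^-1` A).
  by rewrite /r /= fineK// fin_num_measure.
suff : mrestr P mXA B = mscale r P B.
  by rewrite /mrestr /= setIC => ->; rewrite -rE.
apply: (@g_sigma_algebra_measure_unique _ R Omega G other_cylinders_measurable
  (fun=> setT) (fun=> other_cylinders_setT) _ (mrestr P mXA) (mscale r P)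
  other_cylinders_setI) => //.
- by apply/seteqP; split => // w _; exists 0%N.
- move=> _ [C mC ->].
  rewrite /mrestr /= -[RHS]/(r%:num%:E * _)%E rE.
  (* One family covers both product rules, on D and on D minus k0. *)
  pose C' k := if k == k0 then A else C k.
  have C'0 : C' k0 = A by rewrite /C' eqxx.
  have C'n k : k \in (D :\ k0)%SET -> C' k = C k.
    by rewrite in_setD1 /C' => /andP[/negbTE ->].
  have mC' k : measurable (C' k) by rewrite /C'; case: ifP.
  have := indep (subxx D) (fun k _ => mC' k).
  rewrite (big_setD1 k0)//= C'0.
  rewrite -(@indep _ C' (subD1set D k0) (fun k _ => mC' k)).
  have -> : \bigcap_(k in [set` (D :\ k0)%SET]) (X k @^-1` C' k) =
            \bigcap_(k in [set` (D :\ k0)%SET]) (X k @^-1` C k).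
    by apply: eq_bigcapr => k kD; rewrite C'n.
  move=> <-; congr (P _).
  apply/seteqP; split => w /=.
    move=> [h h0] k kD; have [->|kk0] := eqVneq k k0; first by rewrite C'0.
    have kD' : k \in (D :\ k0)%SET by rewrite in_setD1 kk0.
    by have := h k kD'; rewrite /= C'n.
  move=> h; split.
    move=> k kD; have := h k; rewrite /= C'n//; apply.
    by move: kD; rewrite /= in_setD1 => /andP[].
  by have := h k0 Dk0; rewrite /= C'0.
- move=> _; rewrite -[ltLHS]/(P (setT `&` X k0 @^-1` A)) setTI.
  by rewrite ltey_eq fin_num_measure.
Qed.

(** The joint law of X k0 and a is the product of their laws, so Tonelli's
    theorem allows to integrate over X k0 first, for each value y of a. *)
Lemma integral_independent_le (a : Omega -> R) (F : R * R -> \bar R)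
    (M : \bar R) :
  measurable_fun (T := g_sigma_algebraType G) setT a ->
  measurable_fun [set: R * R] F -> (forall z, 0 <= F z)%E ->
  (forall y, \int[distribution P (X k0)]_x F (x, y) <= M)%E ->
  (\int[P]_w F (X k0 w, a w) <= M)%E.
Proof.
move=> ma mF F0 FM.
have ma' : measurable_fun [set: Omega] a := measurable_of_others ma.
pose aRV : {RV P >-> R} := mfun_Sub (mem_set ma').
have mXa : measurable_fun [set: Omega] (fun w => (X k0 w, a w)).
  by apply/measurable_fun_pairP; split.
pose Xa := mfun_Sub (mem_set mXa).
have E : forall S : set (R * R), measurable S ->
    (distribution P (X k0) \x distribution P aRV)%E S = distribution P Xa S.
  apply: product_measure_unique => A B mA mB /=.
  rewrite /distribution /pushforward /=.
  have -> : (fun w => (X k0 w, a w)) @^-1` (A `*` B) =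
            (X k0 @^-1` A) `&` (a @^-1` B) by [].
  rewrite independent_of_others//.
  by rewrite -[X in <<s _ >> X]setTI; exact: ma.
rewrite -[leLHS](ge0_integral_distribution (P := P) Xa mF F0).
rewrite (eq_measure_integral (distribution P (X k0) \x distribution P aRV)%E);
  last by move=> S mS _; exact/esym/E.
rewrite fubini_tonelli2//.
have M0 : (0 <= M)%E.
  by apply: le_trans (FM 0); apply: integral_ge0.
apply: (@le_trans _ _ (\int[distribution P aRV]_y (cst M y))%E).
  apply: ge0_le_integral => //.
  - by move=> y _; apply: integral_ge0.
  - exact: measurable_fun_fubini_tonelli_G.
  - by move=> y _; exact: FM.
by rewrite integral_cst// -[X in (M * X)%E]/(distribution P aRV setT)
  probability_setT mule1.
Qed.

End independence.

(** * Triangular systems as functions of one datum *)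

Section triangular_systems.
Context (R : realType) (n : nat).
Implicit Types (L E : 'M[R]_n) (b x : 'cV[R]_n).

Lemma trig_unitmx L : is_trig_mx L -> (L \in unitmx) = [forall i, L i i != 0].
Proof.
move=> tL; rewrite unitmxE (det_trig tL) unitfE; apply/prodf_neq0/forallP => h i.
  exact: h.
by move=> _; exact: h.
Qed.

(** Row i of L V = 1 expresses V i j through V k j with k < i. *)
Lemma invmx_trig L (i j : 'I_n) : is_trig_mx L -> L \in unitmx -> (i < j)%N ->
  invmx L i j = 0.
Proof.
move=> tL uL; have := uL; rewrite trig_unitmx// => /forallP d0.
have [m] := ubnP (i : nat); elim: m i => // m IH i; rewrite ltnS => im ij.
have := congr1 (fun A : 'M[R]_n => A i j) (mulmxV uL).
rewrite !mxE (bigD1 i)//= big1 ?addr0 => [|k ki].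
  have -> : (i == j) = false by apply/negbTE; rewrite neq_ltn ij.
  by move/eqP; rewrite mulf_eq0 (negbTE (d0 i))/= => /eqP.
have [ik|ki'|/val_inj ik] := ltngtP i k.
- by move/is_trig_mxP : tL => ->//; rewrite mul0r.
- by rewrite IH ?mulr0//; [exact: leq_trans im|exact: ltn_trans ij].
- by rewrite ik eqxx in ki.
Qed.

Definition zero_entry L (j k : 'I_n) : 'M[R]_n :=
  \matrix_(r, s) if (r == j) && (s == k) then 0 else L r s.

Definition zero_coord b (j : 'I_n) : 'cV[R]_n :=
  \col_r if r == j then 0 else b r 0.

Section below_diagonal_entry.
Context (L : 'M[R]_n) (b : 'cV[R]_n) (j k : 'I_n).
Hypotheses (tL : is_trig_mx L) (uL : L \in unitmx) (kj : (k < j)%N).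
Let L0 := zero_entry L j k.

Lemma zero_entry_trig : is_trig_mx L0.
Proof.
apply/is_trig_mxP => r s rs; rewrite mxE; case: ifP => // _.
by move/is_trig_mxP : tL => ->.
Qed.

Lemma zero_entry_unitmx : L0 \in unitmx.
Proof.
have tL0 := zero_entry_trig.
move: uL; rewrite !trig_unitmx// => /forallP d0; apply/forallP => i.
rewrite mxE; case: ifP => // /andP[/eqP ij /eqP ik].
by move: kj; rewrite -ij -ik ltnn.
Qed.

(** L and L0 differ by a matrix of rank one; this is the resolvent identity
    for their inverses, read entrywise. *)
Lemma invmx_zero_entry (r s : 'I_n) :
  invmx L r s = invmx L0 r s - L j k * invmx L0 r j * invmx L k s.
Proof.
have uL0 := zero_entry_unitmx.
have LE : L = L0 + L j k *: delta_mx j k.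
  apply/matrixP => a c; rewrite !mxE.
  by have [->|_] := eqVneq a j; have [->|_] := eqVneq c k;
    rewrite ?mulr1 ?mulr0 ?add0r ?addr0.
have VL : invmx L0 *m L = 1%:M + L j k *: (col j (invmx L0) *m 'e_k).
  rewrite [in LHS]LE mulmxDr mulVmx// -scalemxAr colE -mulmxA.
  by rewrite mul_delta_mx.
have : invmx L0 *m L *m invmx L = invmx L0 by rewrite -mulmxA mulmxV// mulmx1.
rewrite VL mulmxDl mul1mx -scalemxAl -mulmxA -rowE.
move=> /(congr1 (fun A : 'M[R]_n => A r s)); rewrite !mxE big_ord1 !mxE => <-.
by ring.
Qed.

(** Since k < j, row k of the inverse and x_k do not change when the entry
    (j, k) is set to 0; hence x_i is affine in L j k, with coefficients
    computed from L0. *)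
Lemma solution_zero_entry (i : 'I_n) : (invmx L *m b) i 0 =
  (invmx L0 *m b) i 0 - L j k * (invmx L0 i j * (invmx L0 *m b) k 0).
Proof.
have kE s : invmx L k s = invmx L0 k s.
  rewrite invmx_zero_entry [X in _ - _ * X * _](invmx_trig zero_entry_trig)//.
    by rewrite mulr0 mul0r subr0.
  exact: zero_entry_unitmx.
rewrite !mxE !mulr_sumr -sumrB; apply: eq_bigr => s _.
by rewrite invmx_zero_entry kE; ring.
Qed.

Lemma entry_quotient_zero_entry (i : 'I_n) :
  L j k * invmx L i j * (invmx L *m b) k 0 =
  L j k * (invmx L0 i j * (invmx L0 *m b) k 0).
Proof.
have uL0 := zero_entry_unitmx; have tL0 := zero_entry_trig.
rewrite solution_zero_entry (invmx_trig tL0 uL0 kj) mul0r mulr0 subr0.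
rewrite invmx_zero_entry (invmx_trig tL uL kj) mulr0 subr0; ring.
Qed.

End below_diagonal_entry.

Lemma solution_zero_coord L b (i j : 'I_n) :
  (invmx L *m b) i 0 = (invmx L *m zero_coord b j) i 0 + b j 0 * invmx L i j.
Proof.
rewrite !mxE (bigD1 j)//= [in RHS](bigD1 j)//= !mxE eqxx mulr0 add0r addrC mulrC.
congr (_ + _); apply: eq_bigr => k kj.
by rewrite mxE (negbTE kj).
Qed.

(** If be = 0 the left-hand side is 0; otherwise the two sides are equal.  The
    convention y / 0 = 0 makes the inequality hold for all values. *)
Lemma affine_quotient_le (l al be : R) :
  `|l * be / (al + l * be)| <= `|l / (l - (- (al / be)))|.
Proof.
have [->|be0] := eqVneq be 0; first by rewrite mulr0 mul0r normr0.
rewrite opprK (_ : al + l * be = (l + al / be) * be); last by field.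
by rewrite -mulf_div divff// mulr1.
Qed.

(** * From backward error to forward error *)

(** The factor 2 reflects that an entry below the diagonal is perturbed twice:
    directly, and through the normalization of the pivot of its row. *)
Definition amplification L b (i : 'I_n) : R :=
  \sum_(j < n) `|b j 0 * invmx L i j / (invmx L *m b) i 0| +
  2 * \sum_(j < n) \sum_(k < n | (k < j)%N)
     `|L j k * invmx L i j * (invmx L *m b) k 0 / (invmx L *m b) i 0|.

Lemma amplification_ge0 L b i : 0 <= amplification L b i.
Proof.
rewrite addr_ge0 ?sumr_ge0// mulr_ge0// sumr_ge0// => j _.
exact: sumr_ge0.
Qed.

Section backward_error.
Context (L E : 'M[R]_n) (b xt : 'cV[R]_n) (h : R).
Hypotheses (tL : is_trig_mx L) (uL : L \in unitmx) (h0 : 0 <= h) (h1 : h < 1).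
Hypothesis EL : forall i j, `|E i j| <= h * `|L i j|.
Hypothesis xtE : (L + E) *m xt = b.

(** Multiplying row j of L xt - b by 1 + eta, where eta is the relative
    perturbation of the pivot, gives an exact linear expression in eta and the
    E j k, k < j, from which the diagonal term has disappeared. *)
Lemma residual_le (j : 'I_n) : `|(L *m xt - b) j 0| <=
  h / (1 - h) * (`|b j 0| + 2 * \sum_(k < n | (k < j)%N) `|L j k| * `|xt k 0|).
Proof.
have Ljj : L j j != 0 by move: uL; rewrite trig_unitmx// => /forallP.
have upper (k : 'I_n) : (j < k)%N -> L j k = 0 /\ E j k = 0.
  move=> jk; have Ljk : L j k = 0 by move/is_trig_mxP : tL => ->.
  by split=> //; have := EL j k; rewrite Ljk normr0 mulr0 normr_le0 => /eqP.
have split_row (A : 'M[R]_n) : (forall k : 'I_n, (j < k)%N -> A j k = 0) ->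
    (A *m xt) j 0 = A j j * xt j 0 + \sum_(k < n | (k < j)%N) A j k * xt k 0.
  move=> Au; rewrite mxE (bigD1 j)//=; congr (_ + _).
  rewrite (bigID (fun k : 'I_n => (k < j)%N))/= [X in _ + X]big1 ?addr0.
    apply: eq_bigl => k; case: ltngtP => [kj|kj|kj]; rewrite ?andbT ?andbF//.
    by rewrite neq_ltn kj.
  move=> k /andP[kj]; rewrite -leqNgt => jk; rewrite Au ?mul0r//.
  by rewrite ltn_neqAle jk andbT eq_sym.
pose eta := E j j / L j j.
have etah : `|eta| <= h.
  by rewrite normrM normfV ler_pdivrMr ?normr_gt0// EL.
have LE0 (k : 'I_n) : (j < k)%N -> (L + E) j k = 0.
  by move=> /upper[Ljk Ejk]; rewrite mxE Ljk Ejk addr0.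
have L0 (k : 'I_n) : (j < k)%N -> L j k = 0 by move=> /upper[].
have rE : (1 + eta) * (L *m xt - b) j 0 =
    - eta * b j 0 + \sum_(k < n | (k < j)%N) (eta * L j k - E j k) * xt k 0.
  have := congr1 (fun v : 'cV[R]_n => v j 0) xtE.
  rewrite (split_row _ LE0) [in X in X -> _]mxE => rowE.
  rewrite [(L *m xt - b) j 0]mxE (split_row _ L0) [(- b) j 0]mxE.
  under [in RHS]eq_bigr do rewrite mulrBl -mulrA.
  rewrite sumrB -mulr_sumr.
  move: rowE; under eq_bigr do rewrite mxE mulrDl.
  rewrite big_split/=.
  have EjjE : E j j = eta * L j j by rewrite /eta divfK.
  rewrite EjjE => /eqP; rewrite eq_sym -subr_eq0 => /eqP rowE.
  move: (\sum_(k < n | (k < j)%N) L j k * xt k 0) rowE => S.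
  move: (\sum_(k < n | (k < j)%N) E j k * xt k 0) => S' rowE.
  have : b j 0 = (L j j + eta * L j j) * xt j 0 + (S + S').
    by apply/eqP; rewrite -subr_eq0 rowE.
  by move=> ->; ring.
rewrite mulrAC ler_pdivlMr ?subr_gt0//.
have eta1 : 1 - h <= `|1 + eta|.
  have := lerB_normD (1 : R) eta; rewrite normr1.
  by apply: le_trans; rewrite lerB.
apply: (@le_trans _ _ (`|(1 + eta) * (L *m xt - b) j 0|)).
  by rewrite normrM mulrC ler_wpM2r.
rewrite rE mulrDr (le_trans (ler_normD _ _))// lerD//.
  by rewrite normrM normrN ler_wpM2r.
rewrite (le_trans (ler_norm_sum _ _ _))// mulrA mulr_sumr ler_sum// => k _.
rewrite normrM mulrA ler_wpM2r// (le_trans (ler_normB _ _))//.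
rewrite mulr2n mulrDr mulr1 mulrDl lerD ?EL// normrM ler_wpM2r//.
Qed.

(** xt - x = V (L xt - b), and the residual in row j only involves xt_k with
    k < j <= i, for which the induction hypothesis gives
    |xt_k| <= (1 + e W)^i |x_k|. *)
Lemma forward_error_le (W : R) :
  (forall i, (invmx L *m b) i 0 != 0) ->
  (forall i, amplification L b i <= W) ->
  forall i, `|xt i 0 - (invmx L *m b) i 0| / `|(invmx L *m b) i 0| <=
    h / (1 - h) * W * (1 + h / (1 - h) * W) ^+ n.
Proof.
set x := invmx L *m b; set e := h / (1 - h) => x0 ampW i0.
have e0 : 0 <= e by rewrite divr_ge0// subr_ge0 ltW.
have W0 : 0 <= W := le_trans (amplification_ge0 L b i0) (ampW i0).
have eW0 : 0 <= e * W by rewrite mulr_ge0.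
suff claim (i : 'I_n) :
    `|xt i 0 - x i 0| <= e * W * (1 + e * W) ^+ i * `|x i 0|.
  rewrite ler_pdivrMr ?normr_gt0//; apply: le_trans (claim i0) _.
  rewrite ler_wpM2r// ler_wpM2l//; apply: ler_weXn2l; first by rewrite lerDl.
  by rewrite ltnW.
have [m] := ubnP (i : nat); elim: m i => // m IH i; rewrite ltnS => im.
set g := (1 + e * W) ^+ i.
have g1 : 1 <= g by rewrite exprn_ege1// lerDl.
have xtk (k : 'I_n) : (k < i)%N -> `|xt k 0| <= g * `|x k 0|.
  move=> ki; have := IH k (leq_trans ki im) => IHk.
  rewrite -[xt k 0](subrK (x k 0)) (le_trans (ler_normD _ _))//.
  rewrite (le_trans (lerD IHk (lexx _)))// -[X in _ + X]mul1r -mulrDl ler_wpM2r//.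
  apply: (@le_trans _ _ ((1 + e * W) ^+ k.+1)).
    rewrite exprS mulrDl mul1r addrC lerD2r exprn_ege1// lerDl//.
  by apply: ler_weXn2l => //; rewrite lerDl.
have -> : xt i 0 - x i 0 = (invmx L *m (L *m xt - b)) i 0.
  by rewrite mulmxBr mulKmx// !mxE.
rewrite mxE (le_trans (ler_norm_sum _ _ _))//.
apply: (@le_trans _ _ (\sum_(j < n) `|invmx L i j| * (e * (g * (`|b j 0| +
    2 * \sum_(k < n | (k < j)%N) `|L j k| * `|x k 0|))))).
  apply: ler_sum => j _; rewrite normrM.
  have [ij|ji] := ltnP i j; first by rewrite (invmx_trig tL uL ij) normr0 !mul0r.
  rewrite ler_wpM2l// (le_trans (residual_le j))// -/e ler_wpM2l// mulrDr lerD//.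
    by rewrite ler_peMl.
  rewrite mulrCA ler_wpM2l// mulr_sumr ler_sum// => k kj.
  by rewrite mulrCA ler_wpM2l// xtk// (leq_trans kj).
have ampE : `|x i 0| * amplification L b i = \sum_(j < n) `|invmx L i j| *
    (`|b j 0| + 2 * \sum_(k < n | (k < j)%N) `|L j k| * `|x k 0|).
  rewrite /amplification -/x mulrDr mulrCA !mulr_sumr -big_split/=.
  apply: eq_bigr => j _; rewrite mulrDr; congr (_ + _).
    by rewrite normrM normfV normrM mulrCA mulfV ?normr_eq0// mulr1 mulrC.
  rewrite [RHS]mulrCA; congr (_ * _); rewrite !mulr_sumr; apply: eq_bigr => k _.
  rewrite normrM normfV !normrM mulrCA mulfV ?normr_eq0// mulr1.
  by rewrite [RHS]mulrA [X in X * _]mulrC.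
have -> : \sum_(j < n) `|invmx L i j| * (e * (g * (`|b j 0| +
    2 * \sum_(k < n | (k < j)%N) `|L j k| * `|x k 0|))) =
    e * g * (`|x i 0| * amplification L b i).
  by rewrite ampE mulr_sumr; apply: eq_bigr => j _; ring.
rewrite [leRHS](_ : _ = e * g * (`|x i 0| * W)); last by ring.
by rewrite !ler_wpM2l// mulr_ge0// (le_trans ler01).
Qed.

End backward_error.
End triangular_systems.

(** * Measurability of matrix functions *)

Section measurability.
Context d (T : measurableType d) (R : realType).

Lemma measurable_det n (A : T -> 'M[R]_n) :
  (forall i j, measurable_fun [set: T] (fun w => A w i j)) ->
  measurable_fun [set: T] (fun w => \det (A w)).
Proof.
move=> mA; rewrite /determinant; apply: measurable_sum => s.
by apply: measurable_funM => //; apply: measurable_prod.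
Qed.

Lemma measurable_invmx n (A : T -> 'M[R]_n) (i j : 'I_n) :
  (forall i j, measurable_fun [set: T] (fun w => A w i j)) ->
  measurable_fun [set: T] (fun w => invmx (A w) i j).
Proof.
move=> mA; have mdet := measurable_det mA.
rewrite (_ : (fun w => _) = (fun w => if \det (A w) == 0 then A w i j
    else (\det (A w))^-1 * cofactor (A w) j i)); last first.
  apply/funext => w; rewrite /invmx unitmxE unitfE.
  by have [//|_] := eqVneq (\det (A w)) 0; rewrite !mxE.
apply: measurable_fun_ifT => //; first exact: measurable_fun_eqr.
apply: measurable_funM.
  by apply: measurableT_comp => //; exact: measurable_invr.
apply: measurable_funM => //; apply: measurable_det => r s.
by under eq_fun do rewrite !mxE; exact: mA.
Qed.

Lemma measurable_mulmx_cV n (A : T -> 'M[R]_n) (v : T -> 'cV[R]_n) (i : 'I_n) :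
  (forall i j, measurable_fun [set: T] (fun w => A w i j)) ->
  (forall i, measurable_fun [set: T] (fun w => v w i 0)) ->
  measurable_fun [set: T] (fun w => (A w *m v w) i 0).
Proof.
move=> mA mv; under eq_fun do rewrite mxE.
by apply: measurable_sum => k; exact: measurable_funM.
Qed.

End measurability.

(** The integral of f is at most that of its positive part, and the integral
    of a nonnegative function is a supremum over the simple functions below
    it, hence monotone even without measurability. *)
Lemma integral_le_nonneg d (T : measurableType d) (R : realType)
    (mu : {measure set T -> \bar R}) (f g : T -> \bar R) :
  (forall x, f x <= g x)%E -> (forall x, 0 <= g x)%E ->
  (\int[mu]_x f x <= \int[mu]_x g x)%E.
Proof.
move=> fg g0; rewrite [leLHS]integralE.
apply: (@le_trans _ _ (\int[mu]_x f^\+ x)%E).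
  by rewrite -[leRHS]adde0 leeD2l// oppe_le0; apply: integral_ge0.
rewrite !ge0_integralTE//; apply: ereal_sup_le => _ [h hf <-] /=.
exists h => // x; rewrite (le_trans (hf x))//.
by rewrite funeposE ge_max fg g0.
Qed.

(** The Borel sets of R come with two measurable structures, that of the type
    of numbers for the law of X and that of the Stieltjes construction for
    [normal_prob]; the identity is measurable from the second to the first. *)
Lemma ge0_integral_gaussian d (Omega : measurableType d) (R : realType)
    (P : probability Omega R) (X : {RV P >-> R}) (m s : R) (f : R -> \bar R) :
  is_gaussian X m s -> measurable_fun [set: R] f -> (forall x, 0 <= f x)%E ->
  (\int[distribution P X]_x f x = \int[normal_prob m s]_x f x)%E.
Proof.
move=> Xgauss mf f0.
have mid : @measurable_fun _ _ (measurableTypeR R) R setT idfun.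
  exact: (@measurable_id _ (measurableTypeR R) setT).
pose toR := @mfun_Sub _ _ (measurableTypeR R) R idfun (mem_set mid).
transitivity (\int[pushforward (normal_prob m s) toR]_x f x)%E.
  by apply: eq_measure_integral => A mA _; exact: Xgauss.
by rewrite ge0_integral_pushforward.
Qed.

(** * Quotients of independent data *)

Section random_quotients.
Context d (Omega : measurableType d) (R : realType) (P : probability Omega R).
Context (I : finType) (D : {set I}) (X : I -> {RV P >-> R}) (k0 : I).
Hypothesis indep : mutually_independent D X.
Hypothesis Dk0 : k0 \in D.
Variables (m s : R).
Hypothesis Xgauss : is_gaussian (X k0) m s.
Local Notation G := (other_cylinders D X k0).

Lemma integral_gaussian_le (a : Omega -> R) (F : R * R -> \bar R) (M : \bar R) :
  measurable_fun (T := g_sigma_algebraType G) setT a ->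
  measurable_fun [set: R * R] F -> (forall z, 0 <= F z)%E ->
  (forall y, \int[normal_prob m s]_x F (x, y) <= M)%E ->
  (\int[P]_w F (X k0 w, a w) <= M)%E.
Proof.
move=> ma mF F0 FM; apply: (integral_independent_le indep Dk0 ma mF F0) => y.
rewrite (ge0_integral_gaussian Xgauss)//.
by apply: (measurableT_comp mF); exact: measurable_pair2.
Qed.

Definition quotient_powR (p : R) (z : R * R) : \bar R :=
  (`|z.1 / (z.1 - z.2)| `^ p)%:E.

Lemma measurable_quotient_powR p :
  measurable_fun [set: R * R] (quotient_powR p).
Proof.
apply/measurable_EFinP; apply: measurable_powR_comp.
apply: measurableT_comp => //; apply: measurable_funM => //; apply: measurableT_comp => //.
  exact: measurable_invr.
exact: measurable_funB.
Qed.

Lemma quotient_powR_ge0 p z : (0 <= quotient_powR p z)%E.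
Proof. by rewrite lee_fin powR_ge0. Qed.

Lemma integral_quotient_powR_le (a : Omega -> R) (p : R) :
  measurable_fun (T := g_sigma_algebraType G) setT a ->
  0 < s -> `|m| <= 1 -> 0 < p < 1 ->
  (\int[P]_w quotient_powR p (X k0 w, a w) <=
   (((1 - p)^-1 + (Num.sqrt (1 - p))^-1) * ((1 + s) / s) `^ p)%:E)%E.
Proof.
move=> ma s0 m1 p01; apply: integral_gaussian_le => //.
- exact: measurable_quotient_powR.
- exact: quotient_powR_ge0.
- by move=> y; exact: gaussian_quotient_moment.
Qed.

(** Null events of the form X = a enter upper bounds through this function:
    it is infinite on the event, and its integral is 0 nevertheless. *)
Definition infinite_on_diagonal (z : R * R) : \bar R :=
  if z.1 == z.2 then +oo%E else 0%E.

Lemma measurable_infinite_on_diagonal :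
  measurable_fun [set: R * R] infinite_on_diagonal.
Proof. by apply: measurable_fun_ifT => //; exact: measurable_fun_eqr. Qed.

Lemma infinite_on_diagonal_ge0 z : (0 <= infinite_on_diagonal z)%E.
Proof. by rewrite /infinite_on_diagonal; case: ifP. Qed.

Lemma integral_infinite_on_diagonal (a : Omega -> R) :
  measurable_fun (T := g_sigma_algebraType G) setT a ->
  (\int[P]_w infinite_on_diagonal (X k0 w, a w) = 0)%E.
Proof.
move=> ma; apply/eqP; rewrite eq_le; apply/andP; split; last first.
  by apply: integral_ge0 => w _; exact: infinite_on_diagonal_ge0.
apply: integral_gaussian_le => //.
- exact: measurable_infinite_on_diagonal.
- exact: infinite_on_diagonal_ge0.
move=> y.
have N0 : normal_prob m s [set y] = 0%E.
  have /null_content_dominatesP := @normal_prob_dominates R m s.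
  by apply; [exact: measurable_set1|exact: lebesgue_measure_set1].
rewrite (_ : (fun x => _) = (fun x => +oo * (\1_[set y] x)%:E)%E).
  rewrite ge0_integralZl//; last first.
    by apply/measurable_EFinP; exact: measurable_indic.
  by rewrite integral_indic// setIT [X in (_ * X)%E]N0 mule0.
apply/funext => x; rewrite /infinite_on_diagonal indicE /=.
have [->|xy] := eqVneq x y; first by rewrite mem_set//= mule1.
by rewrite memNset ?mule0//= => /eqP; exact/negP.
Qed.

End random_quotients.

(** * Concavity bounds for powers and logarithms *)

Section logarithms.
Context (R : realType).
Implicit Types (x y p K e W Z : R).

(** For t between 0 and 1 one has t <= t^p; apply this to the shares of x and
    y in x + y. *)
Lemma powRD_le x y p : 0 <= x -> 0 <= y -> 0 < p <= 1 ->
  (x + y) `^ p <= x `^ p + y `^ p.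
Proof.
move=> x0 y0 /andP[p0 p1].
have le_powR t : 0 <= t <= 1 -> t <= t `^ p.
  move=> /andP[t0 t1]; have [->|tn0] := eqVneq t 0; first by rewrite powR_ge0.
  by apply: ger1_powR => //; rewrite t1 andbT lt_neqAle eq_sym tn0.
have [xy0|xyn0] := eqVneq (x + y) 0.
  by rewrite xy0 powR0 ?gt_eqF// addr_ge0 ?powR_ge0.
have xy_gt0 : 0 < x + y by rewrite lt_neqAle eq_sym xyn0 addr_ge0.
have scale u : 0 <= u -> u <= x + y ->
    (x + y) `^ p * (u / (x + y)) <= u `^ p.
  move=> u0 uxy; have ut : 0 <= u / (x + y) <= 1.
    by rewrite divr_ge0 ?addr_ge0//= ler_pdivrMr// mul1r.
  have /andP[t0 _] := ut.
  rewrite -[in leRHS](divfK xyn0 u) mulrC powRM ?addr_ge0//.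
  by rewrite ler_wpM2r ?powR_ge0// le_powR.
rewrite -[leLHS]mulr1 -(divff xyn0) mulrDl mulrDr lerD// scale//.
- by rewrite lerDl.
- by rewrite lerDr.
Qed.

Lemma powR_sum_le (I : Type) (r : seq I) (P : pred I) (f : I -> R) p :
  (forall i, P i -> 0 <= f i) -> 0 < p <= 1 ->
  (\sum_(i <- r | P i) f i) `^ p <= \sum_(i <- r | P i) f i `^ p.
Proof.
move=> f0 p01; have /andP[p0 _] := p01.
suff : 0 <= \sum_(i <- r | P i) f i /\
    (\sum_(i <- r | P i) f i) `^ p <= \sum_(i <- r | P i) f i `^ p by case.
elim/big_rec2 : _ => [|i y x Pi [x0 xy]].
  by rewrite lexx powR0 ?gt_eqF.
split; first by rewrite addr_ge0 ?f0.
by rewrite (le_trans (powRD_le _ _ _))// ?f0// lerD2l.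
Qed.

(** Tangent line of the concave function ln at K, after ln W = ln (W^p) / p.
    Once integrated with Z of mean at most K it gives (ln K) / p. *)
Lemma ln_le_powR W Z K p : 0 < W -> 0 < K -> 0 < p -> W `^ p <= Z ->
  ln W <= p^-1 * (Z / K - 1 + ln K).
Proof.
move=> W0 K0 p0 WZ.
have Wp0 : 0 < W `^ p by rewrite powR_gt0.
rewrite -(@ler_pM2l _ p)// mulrA divff ?gt_eqF// mul1r -ln_powR.
have -> : ln (W `^ p) = ln (1 + (W `^ p / K - 1)) + ln K.
  by rewrite subrKC ln_div ?posrE// subrK.
rewrite lerD2r (le_trans (le_ln1Dx _))//; last first.
  by rewrite lerD2r ler_pM2r ?invr_gt0.
by rewrite ltrBrDl subrr divr_gt0.
Qed.

Lemma ln1D_le_powR W Z e p : 0 <= W -> 0 <= e -> 0 < p <= 1 -> W `^ p <= Z ->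
  ln (1 + e * W) <= p^-1 * (e `^ p * Z).
Proof.
move=> W0 e0 p01 WZ; have /andP[p0 _] := p01.
have eW0 : 0 <= e * W by rewrite mulr_ge0.
rewrite -(@ler_pM2l _ p)// mulrA divff ?gt_eqF// mul1r -ln_powR.
apply: (@le_trans _ _ (ln (1 + (e * W) `^ p))).
  rewrite ler_ln ?posrE ?powR_gt0 ?ltr_pwDl ?powR_ge0//.
  by rewrite (le_trans (powRD_le _ _ _))// powR1.
rewrite (le_trans (le_ln1Dx _))//.
  by rewrite (lt_le_trans _ (powR_ge0 _ _))// ltrN10.
by rewrite powRM// ler_wpM2l// powR_ge0.
Qed.

End logarithms.

(** * Sensitivities as quotients *)

Section majorant.
Context (R : realType) (n : nat).
Implicit Types (L E : 'M[R]_n) (b x xt : 'cV[R]_n) (i j k : 'I_n).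

(** The zero of x_i as an affine function of the datum L j k, when this
    function is not constant; it is computed without the entry L j k. *)
Definition entry_shift L b i j k : R :=
  let V := invmx (zero_entry L j k) in
  - ((V *m b) i 0 / - (V i j * (V *m b) k 0)).

(** The analogous zero of x_i as a function of b_j. *)
Definition coord_shift L b i j : R :=
  - ((invmx L *m zero_coord b j) i 0 / invmx L i j).

Lemma entry_quotient_le L b i j k :
  is_trig_mx L -> L \in unitmx -> (k < j)%N ->
  `|L j k * invmx L i j * (invmx L *m b) k 0 / (invmx L *m b) i 0| <=
  `|L j k / (L j k - entry_shift L b i j k)|.
Proof.
move=> tL uL kj; apply: le_trans (affine_quotient_le _ _ _).
by rewrite entry_quotient_zero_entry// (solution_zero_entry b tL uL kj i)
  !mulrN mulNr normrN.
Qed.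

Lemma coord_quotient_le L b i j :
  `|b j 0 * invmx L i j / (invmx L *m b) i 0| <=
  `|b j 0 / (b j 0 - coord_shift L b i j)|.
Proof.
apply: le_trans (affine_quotient_le _ _ _).
by rewrite (solution_zero_coord L b i j).
Qed.

(** Here V i i is nonzero, being the inverse of the pivot L i i, so that
    x_i = 0 determines b_i from the other data. *)
Lemma solution_eq0 L b i : is_trig_mx L -> L \in unitmx ->
  (invmx L *m b) i 0 = 0 -> b i 0 = coord_shift L b i i.
Proof.
move=> tL uL; rewrite (solution_zero_coord L b i i) => /eqP.
have Vii : invmx L i i != 0.
  apply/eqP => Vii; have := congr1 (fun A : 'M[R]_n => A i i) (mulVmx uL).
  rewrite !mxE (bigD1 i)//= Vii mul0r add0r eqxx big1 => [/eqP|k ki].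
    by rewrite eq_sym oner_eq0.
  have [ik|ki'|/val_inj ik] := ltngtP i k.
  - by rewrite (invmx_trig tL uL ik) mul0r.
  - by move/is_trig_mxP : tL => ->//; rewrite mulr0.
  - by rewrite ik eqxx in ki.
rewrite /coord_shift addr_eq0 => /eqP ->.
by rewrite mulNr opprK mulfK.
Qed.

(** A majorant of W^p whose terms have, one by one, a bounded expectation. *)
Definition quotient_sum p L b : \bar R :=
  (\sum_(i < n) (\sum_(j < n) quotient_powR p (b j 0%R, coord_shift L b i j) +
    \sum_(j < n) \sum_(k < n | (k < j)%N)
      2%:E * quotient_powR p (L j k, entry_shift L b i j k)))%E.

Definition degeneracy L b : \bar R :=
  (\sum_(i < n) (infinite_on_diagonal (L i i, 0%R) +
                 infinite_on_diagonal (b i 0%R, coord_shift L b i i)))%E.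

Lemma quotient_sumE p L b : quotient_sum p L b =
  (\sum_(i < n) (\sum_(j < n) `|b j 0 / (b j 0 - coord_shift L b i j)| `^ p +
    \sum_(j < n) \sum_(k < n | (k < j)%N)
      2 * `|L j k / (L j k - entry_shift L b i j k)| `^ p))%:E.
Proof.
rewrite /quotient_sum -sumEFin; apply: eq_bigr => i _.
rewrite [RHS]EFinD; congr (_ + _)%E; rewrite -sumEFin //.
by apply: eq_bigr => j _; rewrite -sumEFin.
Qed.

Lemma amplification_powR_le p L b : is_trig_mx L -> L \in unitmx ->
  0 < p <= 1 ->
  (((\sum_i amplification L b i) `^ p)%:E <= quotient_sum p L b)%E.
Proof.
move=> tL uL p01; have /andP[p0 p1] := p01.
rewrite quotient_sumE lee_fin (le_trans (powR_sum_le _ _ _))//.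
  by move=> i _; exact: amplification_ge0.
apply: ler_sum => i _; rewrite (le_trans (powRD_le _ _ p01))//.
- exact: sumr_ge0.
- by rewrite mulr_ge0// sumr_ge0// => j _; exact: sumr_ge0.
apply: lerD.
  rewrite (le_trans (powR_sum_le _ _ _))//; apply: ler_sum => j _.
  by rewrite ge0_ler_powR ?nnegrE ?(ltW p0)// coord_quotient_le.
rewrite mulr_sumr (le_trans (powR_sum_le _ _ _))//.
  by move=> j _; rewrite mulr_ge0// sumr_ge0.
apply: ler_sum => j _; rewrite mulr_sumr (le_trans (powR_sum_le _ _ _))//.
apply: ler_sum => k kj; rewrite powRM// ler_pM ?powR_ge0//.
  by apply: ler1_powR => //; rewrite ler1n.
by rewrite ge0_ler_powR ?nnegrE ?(ltW p0)// entry_quotient_le.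
Qed.

Lemma degeneracy_ge0 L b : (0 <= degeneracy L b)%E.
Proof.
by apply: sume_ge0 => i _; rewrite adde_ge0 ?infinite_on_diagonal_ge0.
Qed.

Lemma degeneracyy L b i : (L i i = 0) \/ (b i 0 = coord_shift L b i i) ->
  degeneracy L b = +oo%E.
Proof.
move=> h; rewrite /degeneracy (bigD1 i)//=.
have -> : (infinite_on_diagonal (L i i, 0%R) +
           infinite_on_diagonal (b i 0%R, coord_shift L b i i) = +oo)%E.
  case: h => h; rewrite /infinite_on_diagonal /= h eqxx.
    by rewrite addye//; case: ifP.
  by rewrite addey//; case: ifP.
rewrite addye// gt_eqF// (lt_le_trans ltNy0)// sume_ge0// => k _.
by rewrite adde_ge0 ?infinite_on_diagonal_ge0.
Qed.

End majorant.

(** * Loss of precision of one system *)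

Section pointwise_bound.
Context (R : realType) (n : nat).
Implicit Types (L E : 'M[R]_n) (b x xt : 'cV[R]_n) (c eps p K : R).

(** [LoP_le] bounds the loss of precision by an affine function of
    [quotient_sum]; these are its two coefficients.  The parameter K is the
    point at which the logarithm is linearized. *)
Definition lop_offset c eps p K : R :=
  (ln c - ln (1 - c * eps) + p^-1 * (ln K - 1)) / ln 10.

Definition lop_slope c eps p K : R :=
  p^-1 * (K^-1 + n%:R * (c * eps / (1 - c * eps)) `^ p) / ln 10.

Lemma RelErrorV_le x xt (r : R) : 0 <= r -> (forall i, x i 0 != 0) ->
  (forall i, `|xt i 0 - x i 0| / `|x i 0| <= r) -> (RelErrorV x xt <= r%:E)%E.
Proof.
move=> r0 x0 h; rewrite /RelErrorV; elim/big_ind : _ => [|u v ur vr|i _].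
- by rewrite lee_fin.
- by rewrite ge_max ur vr.
rewrite /RelError (negbTE (x0 i))/= inver normr_eq0 (negbTE (x0 i)).
by rewrite -EFinM lee_fin.
Qed.

Lemma RelErrorV_ge0 x xt : (0 <= RelErrorV x xt)%E.
Proof.
rewrite /RelErrorV; elim/big_ind : _ => [//|u v ur vr|i _].
  by rewrite le_max ur.
rewrite /RelError; case: ifP => // _.
by rewrite mule_ge0 ?inve_ge0 ?lee_fin.
Qed.

Lemma ln10_gt0 : 0 < ln 10 :> R.
Proof. by rewrite ln_gt0// ltr1n. Qed.

Lemma log10e_fin (r : R) : 0 < r -> log10e r%:E = (ln r / ln 10)%:E.
Proof. by move=> r0; rewrite /log10e lne_EFin. Qed.

(** The hypothesis is the upper bound u <= eps 10^y.  It is exponentiated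
    because u = 0 is allowed: the difference of logarithms is then -oo. *)
Lemma log10e_sub_le (u : \bar R) eps (y : R) : 0 < eps -> (0 <= u)%E ->
  (u <= (eps * expR (y * ln 10))%:E)%E ->
  (log10e (eps^-1)%:E - log10e u^-1 <= y%:E)%E.
Proof.
move=> eps0; case: u => [u| |] //; rewrite lee_fin => u0; rewrite lee_fin => ur.
rewrite log10e_fin ?invr_gt0// inver.
have [_|un0] := eqVneq u 0.
  rewrite {1}/log10e /= mulyr gtr0_sg ?invr_gt0 ?ln10_gt0// mul1e /=.
  by rewrite addeNy leNye.
have u_gt0 : 0 < u by rewrite lt_neqAle eq_sym un0.
rewrite log10e_fin ?invr_gt0// -EFinB lee_fin -mulrBl ler_pdivrMr ?ln10_gt0//.
rewrite !lnV ?posrE// opprK addrC lerBlDl -[y * _]expRK -lnM ?posrE ?expR_gt0//.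
by rewrite ler_ln ?posrE ?mulr_gt0 ?expR_gt0.
Qed.

(** Off the degenerate events the relative error is at most
    e W (1 + e W)^n; taking logarithms, ln W is bounded by its tangent line and
    ln (1 + e W) by (e W)^p / p. *)
Lemma LoP_le L b xt c eps p K :
  is_trig_mx L -> 0 < eps -> 0 < c -> c * eps < 1 -> 0 < p <= 1 -> 0 < K ->
  (L \in unitmx -> exists E, (forall i j, `|E i j| <= c * eps * `|L i j|) /\
    (L + E) *m xt = b) ->
  (LoP eps L b xt <= (lop_offset c eps p K)%:E +
     (lop_slope c eps p K)%:E * quotient_sum p L b + degeneracy L b)%E.
Proof.
move=> tL eps0 c0 ceps1 p01 K0 solved; have /andP[p0 p1] := p01.
have [[i hi]|nondeg] := pselect
  (exists i, L i i = 0 \/ b i 0 = coord_shift L b i i).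
  by rewrite (degeneracyy hi) addey ?leey// quotient_sumE.
have uL : L \in unitmx.
  rewrite trig_unitmx//; apply/forallP => i; apply/eqP => Lii.
  by apply: nondeg; exists i; left.
have x0 i : (invmx L *m b) i 0 != 0.
  by apply/eqP => xi; apply: nondeg; exists i; right; exact: solution_eq0.
rewrite /LoP uL -[leLHS]adde0 leeD ?degeneracy_ge0//.
have [E [EL xtE]] := solved uL.
have h0 : 0 < c * eps by rewrite mulr_gt0.
have q0 : 0 < 1 - c * eps by rewrite subr_gt0.
set e := c * eps / (1 - c * eps).
have e0 : 0 < e by rewrite divr_gt0.
pose W := \sum_i amplification L b i.
have ampW i : amplification L b i <= W.
  by rewrite /W (bigD1 i)//= lerDl sumr_ge0// => k _; exact: amplification_ge0.
have W0 : 0 <= W by apply: sumr_ge0 => i _; exact: amplification_ge0.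
have fwd := forward_error_le tL uL (ltW h0) ceps1 EL xtE x0 ampW.
have := amplification_powR_le b tL uL p01; rewrite -/W quotient_sumE.
set Z := (\sum_(i < n) _ : R); rewrite lee_fin => WZ.
rewrite [X in (_ <= X)%E](_ : _ =
    (lop_offset c eps p K + lop_slope c eps p K * Z)%:E)//.
apply: log10e_sub_le => //; first exact: RelErrorV_ge0.
have WZ0 : 0 <= Z by apply: le_trans WZ; exact: powR_ge0.
apply: RelErrorV_le => //; first by rewrite mulr_ge0 ?expR_ge0 ?ltW.
move=> i; apply: le_trans (fwd i) _; rewrite -/e.
have [W_eq0|Wn0] := eqVneq W 0.
  by rewrite W_eq0 mulr0 mul0r mulr_ge0 ?expR_ge0 ?ltW.
have W_gt0 : 0 < W by rewrite lt_neqAle eq_sym Wn0.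
have g0 : 0 < 1 + e * W by rewrite ltr_pwDl// mulr_ge0 ?ltW.
have gn0 : 0 < (1 + e * W) ^+ n by rewrite exprn_gt0.
have eW0 : 0 < e * W := mulr_gt0 e0 W_gt0.
rewrite -ler_ln ?posrE; [|exact: mulr_gt0|by rewrite mulr_gt0 ?expR_gt0].
rewrite [leLHS]lnM ?posrE// [ln (e * W)]lnM ?posrE// lnXn//.
rewrite [leRHS]lnM ?posrE ?expR_gt0// expRK.
have -> : ln e = ln c + ln eps - ln (1 - c * eps).
  by rewrite ln_div ?posrE// lnM ?posrE.
rewrite mulrDl /lop_offset /lop_slope -/e divfK ?gt_eqF ?ln10_gt0//.
rewrite [X in _ + (_ + X)](_ : _ = p^-1 * (K^-1 + n%:R * e `^ p) * Z); last first.
  by rewrite mulrAC divfK// gt_eqF// ln10_gt0.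
have h1 := ln_le_powR W_gt0 K0 p0 WZ.
have h2 := ln1D_le_powR W0 (ltW e0) p01 WZ.
rewrite -[ln (1 + e * W) *+ n]mulr_natl.
have h3 : n%:R * ln (1 + e * W) <= n%:R * (p^-1 * (e `^ p * Z)).
  by rewrite ler_wpM2l.
have -> : ln eps + (ln c - ln (1 - c * eps) + p^-1 * (ln K - 1) +
   p^-1 * (K^-1 + n%:R * e `^ p) * Z) =
   ln c + ln eps - ln (1 - c * eps) + p^-1 * (Z / K - 1 + ln K) +
   n%:R * (p^-1 * (e `^ p * Z)) by ring.
by rewrite !lerD.
Qed.

End pointwise_bound.

Lemma mx_entry_le_norm (R : realType) (m n : nat) (A : 'M[R]_(m, n)) i j :
  `|A i j| <= `|A|.
Proof.
rewrite [leRHS]/Num.norm/= mx_normrE.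
exact: (le_bigmax _ (fun ij : 'I_m * 'I_n => `|A ij.1 ij.2|) (i, j)).
Qed.

(** * Expectations over the random data *)

Section expectations.
Context d (Omega : measurableType d) (R : realType) (P : probability Omega R).
Context (n : nat) (Lbar : 'M[R]_n) (bbar : 'cV[R]_n) (s : R).
Context (L : 'I_n -> 'I_n -> {RV P >-> R}) (b : 'I_n -> {RV P >-> R}).
Hypotheses (s0 : 0 < s) (Lbar_le1 : `|Lbar| <= 1) (bbar_le1 : `|bbar| <= 1).
Hypothesis gaussian : gaussian_triangular Lbar bbar s L b.
Implicit Types (i j k : 'I_n) (w : Omega).

Local Notation D := (random_index n).
Local Notation X := (data_entry L b).
Local Notation others k0 := (g_sigma_algebraType (other_cylinders D X k0)).
Local Notation Lw := (random_mx L).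
Local Notation bw := (random_cV b).

Lemma random_mx_trig w : is_trig_mx (Lw w).
Proof.
case: gaussian => _ upper _ _; apply/is_trig_mxP => i j ij.
by rewrite mxE upper.
Qed.

Lemma measurable_other_mx_entry (k0 : 'I_n * 'I_n + 'I_n) i j :
  inl (i, j) != k0 ->
  measurable_fun (T := others k0) setT (fun w => Lw w i j).
Proof.
move=> ijk0; case: gaussian => _ upper _ _.
rewrite (_ : (fun w => _) = (L i j : Omega -> R)); last first.
  by apply/funext => w; rewrite mxE.
have [ij|ji] := ltnP i j.
  rewrite (_ : (L i j : Omega -> R) = cst 0)//.
  by apply/funext => w; rewrite upper.
by apply: (@measurable_other _ _ _ P _ D X k0 (inl (i, j))); rewrite ?inE.
Qed.

Lemma measurable_other_cV_entry (k0 : 'I_n * 'I_n + 'I_n) i :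
  inr i != k0 ->
  measurable_fun (T := others k0) setT (fun w => bw w i 0).
Proof.
move=> ik0; rewrite (_ : (fun w => _) = (b i : Omega -> R)); last first.
  by apply/funext => w; rewrite mxE.
by apply: (@measurable_other _ _ _ P _ D X k0 (inr i)); rewrite ?inE.
Qed.

(** The entry (j, k) is replaced by 0 in [entry_shift], so only the other
    data enter. *)
Lemma measurable_entry_shift i j k :
  measurable_fun (T := others (inl (j, k))) setT
    (fun w => entry_shift (Lw w) (bw w) i j k).
Proof.
have mL0 r c : measurable_fun (T := others (inl (j, k))) setT
    (fun w => zero_entry (Lw w) j k r c).
  under eq_fun do rewrite mxE.
  have [->|rj] := eqVneq r j; last first.
    by apply: measurable_other_mx_entry; apply/eqP => -[E];
      rewrite E eqxx in rj.
  have [_|ck] := eqVneq c k; first exact: measurable_cst.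
  by apply: measurable_other_mx_entry; apply/eqP => -[E];
    rewrite E eqxx in ck.
have mb r : measurable_fun (T := others (inl (j, k))) setT (fun w => bw w r 0).
  exact: measurable_other_cV_entry.
have mV r c : measurable_fun (T := others (inl (j, k))) setT
    (fun w => invmx (zero_entry (Lw w) j k) r c) by exact: measurable_invmx.
have mVb r : measurable_fun (T := others (inl (j, k))) setT
    (fun w => (invmx (zero_entry (Lw w) j k) *m bw w) r 0).
  exact: measurable_mulmx_cV.
apply: measurableT_comp => //; apply: measurable_funM => //.
apply: measurableT_comp; first exact: measurable_invr.
by apply: measurableT_comp => //; exact: measurable_funM.
Qed.

Lemma measurable_coord_shift i j :
  measurable_fun (T := others (inr j)) setT
    (fun w => coord_shift (Lw w) (bw w) i j).
Proof.
have mL r c : measurable_fun (T := others (inr j)) setT (fun w => Lw w r c).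
  exact: measurable_other_mx_entry.
have mb r : measurable_fun (T := others (inr j)) setT
    (fun w => zero_coord (bw w) j r 0).
  under eq_fun do rewrite mxE.
  have [_|rj] := eqVneq r j; first exact: measurable_cst.
  by apply: measurable_other_cV_entry; apply/eqP => -[E];
    rewrite E eqxx in rj.
have mV r c : measurable_fun (T := others (inr j)) setT
    (fun w => invmx (Lw w) r c) by exact: measurable_invmx.
apply: measurableT_comp => //; apply: measurable_funM.
  exact: measurable_mulmx_cV.
by apply: measurableT_comp; first exact: measurable_invr.
Qed.

Lemma measurable_quotient_entry p i j k : measurable_fun [set: Omega]
  (fun w => quotient_powR p (Lw w j k, entry_shift (Lw w) (bw w) i j k)).
Proof.
under eq_fun do rewrite [random_mx L _ j k]mxE.
apply: (measurableT_comp (measurable_quotient_powR p)).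
apply/measurable_fun_pairP; split => //.
exact: (measurable_of_others (@measurable_entry_shift i j k)).
Qed.

Lemma measurable_quotient_coord p i j : measurable_fun [set: Omega]
  (fun w => quotient_powR p (bw w j 0, coord_shift (Lw w) (bw w) i j)).
Proof.
under eq_fun do rewrite [random_cV b _ j 0]mxE.
apply: (measurableT_comp (measurable_quotient_powR p)).
apply/measurable_fun_pairP; split => //.
exact: (measurable_of_others (@measurable_coord_shift i j)).
Qed.

Definition quotient_moment_bound p : R :=
  ((1 - p)^-1 + (Num.sqrt (1 - p))^-1) * ((1 + s) / s) `^ p.

Lemma integral_quotient_entry p i j k : (k < j)%N -> 0 < p < 1 ->
  (\int[P]_w quotient_powR p (Lw w j k, entry_shift (Lw w) (bw w) i j k) <=
   (quotient_moment_bound p)%:E)%E.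
Proof.
move=> kj p01; case: gaussian => gL _ _ indep.
under eq_integral do rewrite [random_mx L _ j k]mxE.
have Dk : inl (j, k) \in D by rewrite inE ltnW.
apply: (integral_quotient_powR_le indep Dk (gL j k (ltnW kj))) => //.
  exact: measurable_entry_shift.
exact: le_trans (mx_entry_le_norm _ _ _) Lbar_le1.
Qed.

Lemma integral_quotient_coord p i j : 0 < p < 1 ->
  (\int[P]_w quotient_powR p (bw w j 0%R, coord_shift (Lw w) (bw w) i j) <=
   (quotient_moment_bound p)%:E)%E.
Proof.
move=> p01; case: gaussian => _ _ gb indep.
under eq_integral do rewrite [random_cV b _ j 0]mxE.
have Dj : inr j \in D by rewrite inE.
apply: (integral_quotient_powR_le indep Dj (gb j)) => //.
  exact: measurable_coord_shift.
exact: le_trans (mx_entry_le_norm _ _ _) bbar_le1.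
Qed.

(** For fixed i there are n data b_j, and n (n - 1) / 2 entries L j k counted
    twice: n + n (n - 1) = n^2 quotients. *)
Lemma integral_quotient_sum p : 0 < p < 1 ->
  (\int[P]_w quotient_sum p (Lw w) (bw w) <=
   (n%:R ^+ 3 * quotient_moment_bound p)%:E)%E.
Proof.
move=> p01; set M := quotient_moment_bound p.
have M0 : 0 <= M.
  have /andP[p0 p1] := p01.
  by rewrite mulr_ge0 ?powR_ge0// addr_ge0// invr_ge0 ?sqrtr_ge0// subr_ge0 ltW.
have q0 z : (0 <= quotient_powR p z :> \bar R)%E by exact: quotient_powR_ge0.
have q20 z : (0 <= 2%:E * quotient_powR p z :> \bar R)%E by rewrite mule_ge0.
have m1 i j := measurable_quotient_coord p i j.
have m2 i j k : measurable_fun [set: Omega] (fun w => 2%:E *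
    quotient_powR p (Lw w j k, entry_shift (Lw w) (bw w) i j k))%E.
  by apply: emeasurable_funM => //; exact: measurable_quotient_entry.
have msum2 i j : measurable_fun [set: Omega] (fun w =>
    \sum_(k < n | (k < j)%N) 2%:E *
    quotient_powR p (Lw w j k, entry_shift (Lw w) (bw w) i j k))%E.
  under eq_fun do rewrite big_mkcond/=.
  by apply: emeasurable_sum => k; case: (k < j)%N.
rewrite /quotient_sum ge0_integral_sum//; last 2 first.
- by move=> i; apply: emeasurable_funD; apply: emeasurable_sum => j.
- move=> i w _; rewrite adde_ge0 ?sume_ge0// => j _; exact: sume_ge0.
apply: (@le_trans _ _ (\sum_(i < n) (n%:R ^+ 2 * M)%:E)%E); last first.
  rewrite sumEFin lee_fin sumr_const card_ord -mulr_natl le_eqVlt.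
  by apply/orP; left; apply/eqP; ring.
apply: lee_sum => i _.
rewrite ge0_integralD//; last 4 first.
- by move=> w _; exact: sume_ge0.
- exact: emeasurable_sum.
- by move=> w _; apply: sume_ge0 => j _; exact: sume_ge0.
- exact: emeasurable_sum.
rewrite ge0_integral_sum// ge0_integral_sum//; last first.
  by move=> j w _; exact: sume_ge0.
rewrite -big_split/=.
apply: (@le_trans _ _ (\sum_(j < n) (M + 2 * (j%:R * M))%:E)%E); last first.
  rewrite sumEFin lee_fin -(big_mkord xpredT (fun r : nat => M + 2 * (r%:R * M))).
  rewrite le_eqVlt; apply/orP; left; apply/eqP; elim: (n) => [|m IH].
    by rewrite big_geq// expr0n mul0r.
  by rewrite big_nat_recr//= IH -natr1; ring.
apply: lee_sum => j _; rewrite [leRHS]EFinD; apply: leeD.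
  exact: integral_quotient_coord.
rewrite [X in (X <= _)%E](_ : _ = \sum_(k < n | (k < j)%N) \int[P]_w (2%:E *
    quotient_powR p (Lw w j k, entry_shift (Lw w) (bw w) i j k)))%E; last first.
  under eq_integral do rewrite big_mkcond/=.
  rewrite ge0_integral_sum//; last 2 first.
  - by move=> k; case: (k < j)%N.
  - by move=> k w _; case: ifP.
  rewrite [RHS]big_mkcond/=; apply: eq_bigr => k _.
  by case: (k < j)%N => //; rewrite integral0.
apply: (@le_trans _ _ (\sum_(k < n | (k < j)%N) (2 * M)%:E)%E).
  apply: lee_sum => k kj; rewrite ge0_integralZl//.
    by rewrite EFinM lee_wpmul2l// integral_quotient_entry.
  exact: measurable_quotient_entry.
rewrite sumEFin lee_fin sumr_const -mulr_natl le_eqVlt.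
have -> : #|[pred k : 'I_n | (k < j)%N]| = j.
  by rewrite -sum1_card/= (big_ord_narrow (ltnW (ltn_ord j))) sum1_card card_ord.
by apply/orP; left; apply/eqP; ring.
Qed.

Lemma measurable_infinite_diag i : measurable_fun [set: Omega]
  (fun w => infinite_on_diagonal (Lw w i i, 0)).
Proof.
under eq_fun do rewrite [random_mx L _ i i]mxE.
apply: (measurableT_comp (@measurable_infinite_on_diagonal R)).
by apply/measurable_fun_pairP; split => //; exact: measurable_cst.
Qed.

Lemma measurable_infinite_coord i : measurable_fun [set: Omega]
  (fun w => infinite_on_diagonal (bw w i 0, coord_shift (Lw w) (bw w) i i)).
Proof.
under eq_fun do rewrite [random_cV b _ i 0]mxE.
apply: (measurableT_comp (@measurable_infinite_on_diagonal R)).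
apply/measurable_fun_pairP; split => //.
exact: (measurable_of_others (@measurable_coord_shift i i)).
Qed.

Lemma measurable_degeneracy : measurable_fun [set: Omega]
  (fun w => degeneracy (Lw w) (bw w)).
Proof.
by apply: emeasurable_sum => i; apply: emeasurable_funD;
  [exact: measurable_infinite_diag|exact: measurable_infinite_coord].
Qed.

Lemma measurable_quotient_sum p : measurable_fun [set: Omega]
  (fun w => quotient_sum p (Lw w) (bw w)).
Proof.
apply: emeasurable_sum => i; apply: emeasurable_funD; apply: emeasurable_sum => j.
  exact: measurable_quotient_coord.
under eq_fun do rewrite big_mkcond/=.
apply: emeasurable_sum => k; case: (k < j)%N => //.
by apply: emeasurable_funM => //; exact: measurable_quotient_entry.
Qed.

(** L i i is independent of the constant 0, and b_i of its shift; neither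
    takes a prescribed value with positive probability. *)
Lemma integral_degeneracy : (\int[P]_w degeneracy (Lw w) (bw w) = 0)%E.
Proof.
case: gaussian => gL _ gb indep.
have mdiag := measurable_infinite_diag.
have mcoord := measurable_infinite_coord.
have ge0 z : (0 <= infinite_on_diagonal z :> \bar R)%E.
  exact: infinite_on_diagonal_ge0.
rewrite ge0_integral_sum//; last 2 first.
- by move=> i; exact: emeasurable_funD.
- by move=> i w _; rewrite adde_ge0.
rewrite big1// => i _; rewrite ge0_integralD//.
under eq_integral do rewrite [random_mx L _ i i]mxE.
under [X in (_ + X)%E]eq_integral do rewrite [random_cV b _ i 0]mxE.
have Dii : inl (i, i) \in D by rewrite inE.
have Di : inr i \in D by rewrite inE.
rewrite (integral_infinite_on_diagonal indep Dii (gL i i (leqnn i)))//.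
rewrite (integral_infinite_on_diagonal indep Di (gb i)) ?adde0//.
exact: measurable_coord_shift.
Qed.

End expectations.

(** The offset is assumed nonnegative so that the majorant of the loss of
    precision is nonnegative; it then bounds the integral of X and that of its
    positive part alike. *)
Lemma integral_LoP_le d (Omega : measurableType d) (R : realType)
    (P : probability Omega R) (n : nat) (Lbar : 'M[R]_n) (bbar : 'cV[R]_n)
    (s : R) (L : 'I_n -> 'I_n -> {RV P >-> R}) (b : 'I_n -> {RV P >-> R})
    (xt : Omega -> 'cV[R]_n) (c eps p K : R) :
  0 < s -> `|Lbar| <= 1 -> `|bbar| <= 1 ->
  gaussian_triangular Lbar bbar s L b ->
  0 < eps -> 0 < c -> c * eps < 1 -> 0 < p < 1 -> 0 < K ->
  n%:R ^+ 3 * quotient_moment_bound s p <= K -> 0 <= lop_offset c eps p K ->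
  (forall w, random_mx L w \in unitmx -> exists E : 'M[R]_n,
    (forall i j, `|E i j| <= c * eps * `|random_mx L w i j|) /\
    (random_mx L w + E) *m xt w = random_cV b w) ->
  let X := fun w => LoP eps (random_mx L w) (random_cV b w) (xt w) in
  let bound := (lop_offset c eps p K + lop_slope n c eps p K * K)%:E in
  (\int[P]_w (X^\+ w) <= bound)%E /\ (\int[P]_w X w <= bound)%E.
Proof.
move=> s0 Lbar1 bbar1 gaussian eps0 c0 ceps1 p01 K0 MK C0 solved X bound.
have /andP[p0 p1] := p01.
have p01' : 0 < p <= 1 by rewrite p0 ltW.
have C1 : 0 <= lop_slope n c eps p K.
  rewrite mulr_ge0 ?invr_ge0 ?ltW ?ln10_gt0// mulr_gt0 ?invr_gt0//.
  by rewrite ltr_pwDl ?invr_gt0// mulr_ge0// powR_ge0.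
pose QS w := quotient_sum p (random_mx L w) (random_cV b w).
pose Y w := ((lop_offset c eps p K)%:E + (lop_slope n c eps p K)%:E * QS w +
  degeneracy (random_mx L w) (random_cV b w))%E.
have QS0 w : (0 <= QS w)%E.
  rewrite /QS quotient_sumE lee_fin sumr_ge0// => i _.
  rewrite addr_ge0 ?sumr_ge0// => j _.
  by rewrite sumr_ge0// => k _; rewrite mulr_ge0 ?powR_ge0.
have Y0 w : (0 <= Y w)%E by rewrite !adde_ge0 ?mule_ge0 ?degeneracy_ge0.
have XY w : (X w <= Y w)%E.
  by apply: LoP_le => //; [exact: random_mx_trig gaussian w|exact: solved].
have mQS : measurable_fun [set: Omega] QS.
  exact: measurable_quotient_sum gaussian p.
have intY : (\int[P]_w Y w <= bound)%E.
  rewrite /Y ge0_integralD//; last 4 first.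
  - by move=> w _; rewrite adde_ge0 ?mule_ge0.
  - by apply: emeasurable_funD => //; exact: emeasurable_funM.
  - by move=> w _; exact: degeneracy_ge0.
  - exact: measurable_degeneracy gaussian.
  rewrite (integral_degeneracy gaussian) adde0 ge0_integralD//; last 2 first.
  - by move=> w _; rewrite mule_ge0.
  - exact: emeasurable_funM.
  rewrite ge0_integralZl// integral_cst//= probability_setT mule1.
  rewrite /bound [leRHS]EFinD leeD2l// [leRHS]EFinM lee_wpmul2l//.
  apply: le_trans (integral_quotient_sum s0 Lbar1 bbar1 gaussian p01) _.
  by rewrite lee_fin.
split; apply: le_trans intY; apply: integral_le_nonneg => // w.
by rewrite funeposE ge_max XY Y0.
Qed.

(** * Numerical constants and the limit of vanishing machine precision *)

Lemma quotient_moment_three_fifths (R : realType) (s : R) : 0 < s ->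
  quotient_moment_bound s (3 / 5) <= 41 / 10 * ((1 + s) / s) `^ (3 / 5).
Proof.
move=> s0; rewrite ler_wpM2r ?powR_ge0//.
have -> : 1 - 3 / 5 = 2 / 5 :> R by field.
have h : 5 / 8 <= Num.sqrt (2 / 5) :> R.
  rewrite -[leLHS]ger0_norm ?divr_ge0// -sqrtr_sqr ler_wsqrtr//.
  by lra.
have h' : (Num.sqrt (2 / 5))^-1 <= 8 / 5 :> R.
  rewrite -[leRHS]invrK lef_pV2 ?posrE ?invr_gt0 ?divr_gt0//
    ?sqrtr_gt0 ?divr_gt0//.
  by rewrite invf_div.
by lra.
Qed.

(** Multiplied by 3 ln 10, this is the logarithm of
    2^3 (41/10)^5 <= 10^4.356; the integral exponent 4 already suffices. *)
Lemma loss_constant_le (R : realType) :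
  (ln 2 + 5 / 3 * ln (41 / 10)) / ln 10 <= 1452 / 1000 :> R.
Proof.
have h : ln (2 ^+ 3 * (41 / 10) ^+ 5) <= ln (10 ^+ 4) :> R.
  by rewrite ler_ln ?posrE ?mulr_gt0 ?exprn_gt0//; lra.
rewrite ler_pdivrMr ?ln10_gt0//.
move: h; rewrite lnM ?posrE ?exprn_gt0// !lnXn//.
by have := @ln10_gt0 R; lra.
Qed.

Lemma log2_ge1 (R : realType) (n : nat) : (2 <= n)%N -> 1 <= log2 n%:R :> R.
Proof.
move=> n2; have l2 : 0 < ln 2 :> R by rewrite ln_gt0// ltr1n.
rewrite /log2 ler_pdivlMr// mul1r ler_ln ?posrE ?ltr0n ?ler_nat//.
by rewrite (leq_trans _ n2).
Qed.

Lemma vanishing_term_cvg (R : realType) (c C1 C2 p : R) : 0 < p ->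
  (- ln (1 - c * eps) + C1 * eps `^ p) / C2 @[eps --> (0 : R)^'+] --> (0 : R).
Proof.
move=> p0; rewrite -[X in _ --> X](mul0r C2^-1).
apply: cvgM; last exact: cvg_cst.
rewrite -[X in _ --> X]addr0; apply: cvgD; last first.
  rewrite -[X in _ --> X](mulr0 C1).
  by apply: cvgM; [exact: cvg_cst|exact: powR_cvg0].
rewrite -[X in _ --> X]oppr0 -[X in _ --> - X](@ln1 R); apply: cvgN.
apply: cvg_at_right_filter.
apply: (@cvg_comp _ _ _ (fun x : R => 1 - c * x) (@ln R) (nbhs (0 : R))
  (nbhs (1 : R))); last by apply: continuous_ln.
have : 1 - c * x @[x --> (0 : R)] --> (1 - c * 0 : R).
  by apply: cvgB; [exact: cvg_cst|apply: cvgM; [exact: cvg_cst|exact: cvg_id]].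
by rewrite mulr0 subr0.
Qed.

(** With mean K of the quotient sum the linearized logarithm sums to
    (ln K) / p = 5 ln n + (5/3) ln (41/10) + ln ((1 + s) / s).  The power
    e^p, with e = c eps / (1 - c eps) <= 2 c eps, goes to the error term. *)
Lemma loss_bound_le (R : realType) (n : nat) (s eps : R)
    (c := 2 * log2 n%:R) (p := 3 / 5)
    (K := n%:R ^+ 3 * (41 / 10 * ((1 + s) / s) `^ p)) :
  (2 <= n)%N -> 0 < s -> 0 < eps -> c * eps <= 1 / 2 ->
  lop_offset c eps p K + lop_slope n c eps p K * K <=
  log10 ((1 + s) / s) + 5 * log10 n%:R + log10 (log2 n%:R) + 1452 / 1000 +
  (- ln (1 - c * eps) + p^-1 * n%:R * K * (2 * c) `^ p * eps `^ p) / ln 10.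
Proof.
move=> n2 s0 eps0 ceps.
have n0 : 0 < n%:R :> R by rewrite ltr0n (leq_trans _ n2).
have l1 : 1 <= log2 n%:R :> R := log2_ge1 R n2.
have l0 : 0 < log2 n%:R :> R by rewrite (lt_le_trans _ l1).
have c0 : 0 < c by rewrite mulr_gt0.
have p0 : 0 < p by rewrite divr_gt0.
have s1 : 0 < (1 + s) / s by rewrite divr_gt0// addr_gt0.
have K0 : 0 < K by rewrite !mulr_gt0 ?exprn_gt0 ?powR_gt0// divr_gt0.
have l10 := @ln10_gt0 R.
have lnc : ln c = ln 2 + ln (log2 n%:R) by rewrite lnM ?posrE.
have lnK : p^-1 * ln K = 5 * ln n%:R + 5 / 3 * ln (41 / 10) + ln ((1 + s) / s).
  have d0 : 0 < 41 / 10 :> R by rewrite divr_gt0.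
  have t0 : 0 < ((1 + s) / s) `^ p by rewrite powR_gt0.
  have n30 : 0 < n%:R ^+ 3 :> R by rewrite exprn_gt0.
  have dt0 := mulr_gt0 d0 t0.
  rewrite /K [ln (n%:R ^+ 3 * _)]lnM ?posrE// [ln (41 / 10 * _)]lnM ?posrE//.
  rewrite lnXn// ln_powR.
  by rewrite /p; field.
have e_le : (c * eps / (1 - c * eps)) `^ p <= (2 * c) `^ p * eps `^ p.
  have h0 : 0 < c * eps by rewrite mulr_gt0.
  have q0 : 1 / 2 <= 1 - c * eps by lra.
  have q0' : 0 < 1 - c * eps by lra.
  have c20 : 0 <= 2 * c by rewrite mulr_ge0// ltW.
  rewrite -powRM ?(ltW eps0)//; apply: ge0_ler_powR; first exact: ltW.
  - by rewrite nnegrE divr_ge0// ltW.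
  - by rewrite nnegrE mulr_ge0// ltW.
  - rewrite ler_pdivrMr//; nra.
have const := @loss_constant_le R.
rewrite /lop_offset /lop_slope /log10 -/c.
set e := (_ `^ p) in e_le *.
have -> : (ln c - ln (1 - c * eps) + p^-1 * (ln K - 1)) / ln 10 +
    p^-1 * (K^-1 + n%:R * e) / ln 10 * K =
    (ln ((1 + s) / s) / ln 10 + 5 * (ln n%:R / ln 10) + ln (log2 n%:R) / ln 10 +
     (ln 2 + 5 / 3 * ln (41 / 10)) / ln 10) +
    (- ln (1 - c * eps) + p^-1 * n%:R * K * e) / ln 10.
  rewrite mulrBr lnK lnc; field.
  by rewrite !gt_eqF.
rewrite lerD//; first by rewrite lerD2l.
rewrite ler_pM2r ?invr_gt0// lerD2l -[leRHS]mulrA ler_pM2l//.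
by rewrite mulr_gt0// mulr_gt0 ?invr_gt0.
Qed.

Lemma lop_offset_ge0 (R : realType) (n : nat) (s eps : R)
    (c := 2 * log2 n%:R) (p := 3 / 5)
    (K := n%:R ^+ 3 * (41 / 10 * ((1 + s) / s) `^ p)) :
  (2 <= n)%N -> 0 < s -> 0 < eps -> c * eps < 1 -> 0 <= lop_offset c eps p K.
Proof.
move=> n2 s0 eps0 ceps.
have l1 : 1 <= log2 n%:R :> R := log2_ge1 R n2.
have c1 : 1 <= c by rewrite /c; lra.
have s1 : 1 <= ((1 + s) / s) `^ p.
  rewrite -[leLHS](powRr0 ((1 + s) / s)); apply: ler_powR.
    by rewrite ler_pdivlMr// mul1r lerDr.
  by rewrite divr_ge0.
have n3 : 1 <= n%:R ^+ 3 :> R by rewrite exprn_ege1// ler1n (leq_trans _ n2).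
have K4 : 4 <= K.
  have h : 4 <= 41 / 10 * ((1 + s) / s) `^ p by lra.
  rewrite (le_trans h)// ler_peMl//; lra.
have lnK : 1 <= ln K.
  have ln2 : 2^-1 <= ln 2 :> R.
    have := @le_ln1Dx R (- 2^-1); rewrite (_ : 1 + - 2^-1 = 2^-1); last by field.
    rewrite lnV ?posrE// lerN2; apply.
    by rewrite ltrN2 invf_lt1// ltr1n.
  have : ln 4 <= ln K by rewrite ler_ln ?posrE// (lt_le_trans _ K4).
  rewrite (_ : 4 = 2 ^+ 2); last by ring.
  rewrite lnXn// mulr2n; lra.
have lnc : 0 <= ln c by rewrite ln_ge0.
have lnq : ln (1 - c * eps) <= 0.
  by rewrite ln_le0// lerBlDr lerDl mulr_ge0 ?(ltW eps0)//; lra.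
rewrite divr_ge0 ?(ltW (@ln10_gt0 R))// addr_ge0 ?subr_ge0//.
  by rewrite (le_trans lnq).
by rewrite mulr_ge0 ?subr_ge0// invr_ge0 divr_ge0.
Qed.

Theorem corollary1 (R : realType) (n : nat) (sigma : R)
    (Lbar : 'M[R]_n) (bbar : 'cV[R]_n) (n_ge2 : (2 <= n)%N)
    (sigma_gt0 : 0 < sigma) (Lbar_trig : is_trig_mx Lbar)
    (Lbar_le1 : `|Lbar| <= 1) (bbar_le1 : `|bbar| <= 1) :
  exists o1 : R -> R, o1 eps @[eps --> (0 : R)^'+] --> (0 : R) /\
    forall solve : R -> 'M[R]_n -> 'cV[R]_n -> 'cV[R]_n,
    backward_error_guarantee solve ->
    \forall eps \near (0 : R)^'+,
    forall (d : measure_display) (Omega : measurableType d)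
      (P : probability Omega R)
      (L : 'I_n -> 'I_n -> {RV P >-> R}) (b : 'I_n -> {RV P >-> R}),
    gaussian_triangular Lbar bbar sigma L b ->
    (forall i : 'I_n, measurable_fun [set: Omega]
       (fun w => solve eps (random_mx L w) (random_cV b w) i 0)) ->
    let X := fun w => LoP eps (random_mx L w) (random_cV b w)
                        (solve eps (random_mx L w) (random_cV b w)) in
    (\int[P]_w (X^\+ w) < +oo)%E /\
    (\int[P]_w X w <=
      (log10 ((1 + sigma) / sigma) + 5 * log10 n%:R + log10 (log2 n%:R)
       + 1452 / 1000 + o1 eps)%:E)%E.
Proof.
pose c : R := 2 * log2 n%:R; pose p : R := 3 / 5.
pose K : R := n%:R ^+ 3 * (41 / 10 * ((1 + sigma) / sigma) `^ p).
exists (fun eps => (- ln (1 - c * eps) +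
  p^-1 * n%:R * K * (2 * c) `^ p * eps `^ p) / ln 10).
have p0 : 0 < p by rewrite divr_gt0.
split; first exact: vanishing_term_cvg.
move=> solve guarantee.
have l1 : 1 <= log2 n%:R :> R := log2_ge1 R n_ge2.
have c0 : 0 < c by rewrite mulr_gt0// (lt_le_trans _ l1).
near=> eps.
have eps0 : 0 < eps by near: eps; exact: nbhs_right_gt.
have ceps : c * eps <= 1 / 2.
  rewrite mulrC -ler_pdivlMr//; near: eps; apply: nbhs_right_le.
  by rewrite divr_gt0.
have ceps1 : c * eps < 1 by lra.
have Hsolve : forall (L : 'M[R]_n) (b : 'cV[R]_n), is_trig_mx L ->
    L \in unitmx -> exists E : 'M[R]_n,
    (forall i j, `|E i j| <= 2 * log2 n%:R * eps * `|L i j|) /\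
    (L + E) *m solve eps L b = b.
  by near: eps.
move=> d Omega P L b gaussian _.
have K0 : 0 < K.
  have n0 : 0 < n%:R :> R by rewrite ltr0n (leq_trans _ n_ge2).
  by rewrite !mulr_gt0 ?exprn_gt0 ?powR_gt0// ?divr_gt0 ?addr_gt0.
have p01 : 0 < p < 1 by rewrite p0/= /p; lra.
have MK : n%:R ^+ 3 * quotient_moment_bound sigma p <= K.
  by rewrite ler_wpM2l ?exprn_ge0// quotient_moment_three_fifths.
have C0 : 0 <= lop_offset c eps p K by exact: lop_offset_ge0.
have [Xplus Xint] := integral_LoP_le sigma_gt0 Lbar_le1 bbar_le1 gaussian
  eps0 c0 ceps1 p01 K0 MK C0
  (fun w => Hsolve _ (random_cV b w) (random_mx_trig gaussian w)).
split; first exact: le_lt_trans Xplus (ltry _).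
by apply: le_trans Xint _; rewrite lee_fin; exact: loss_bound_le.
Unshelve. all: by end_near. Qed.
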